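(* Let $f=f(u,v)$ be a generalized timelike minimal surface with real Weierstrass data $(g_1,g_2,\hat{\omega}_1du,\hat{\omega}_2dv)$ and let $p$ be a non-degenerate singular point with $\operatorname{rank}(df_p)=1$ and $\hat\omega_2(p)=0$. If $f$ is not a front at $p$, then $f$ is $\mathcal{A}$-equivalent at $p$ to the $(2,5)$-cuspidal edge if and only if \[ \left(\frac{(g_2)_{vv}}{(\hat{\omega}_2)_v}\right)_v(p)\neq0. \]
   Context: $\mathbb{L}^3$ is $\mathbb{R}^3$ with the Lorentzian metric $\langle\,,\rangle=-dt^2+dx^2+dy^2$. A generalized timelike minimal surface is a non-constant smooth map $f\colon\Sigma\to\mathbb{L}^3$ from a 2-manifold which is an immersion on an open dense subset and such that near each point there are local coordinates $(u,v)$ with $\langle f_u,f_u\rangle=\langle f_v,f_v\rangle=0$ and $f_{uv}=0$. In such coordinates $f(u,v)=\tfrac12\int_{u_0}^u(-1-g_1^2,1-g_1^2,2g_1)\hat{\omega}_1du+\tfrac12\int_{v_0}^v(1+g_2^2,1-g_2^2,-2g_2)\hat{\omega}_2dv+f(u_0,v_0)$, with $g_1,\hat\omega_1$ functions of $u$ and $g_2,\hat\omega_2$ functions of $v$ (real Weierstrass data). Standing assumption: $g_1,g_2$ take finite real values at every singular point. Such $f$ is a frontal with unit normal $n=(g_1+g_2,-g_1+g_2,1+g_1g_2)/\sqrt{(1-g_1g_2)^2+2(g_1+g_2)^2}$; $f$ is a front at $p$ if $(f,n)$ is an immersion at $p$. With $\lambda=\det(f_u,f_v,n)$, a singular point is non-degenerate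 if $d\lambda_p\neq0$ (for such $p$ this is equivalent to $(\hat\omega_2)_v(p)\ne0$ and $g_1g_2(p)\ne1$). $\mathcal{A}$-equivalence means equality of map germs up to diffeomorphism germs of source and target. The $(2,5)$-cuspidal edge is the germ at $0$ of $(u,v)\mapsto(u,v^2,v^5)$. *)

(* Defs.v *)
From HB Require Import structures.
From mathcomp Require Import all_boot all_order all_algebra.
From mathcomp Require Import all_classical all_reals all_analysis.
Set Implicit Arguments. Unset Strict Implicit. Unset Printing Implicit Defensive.
Import Order.TTheory GRing.Theory Num.Theory.
Import numFieldNormedType.Exports.
Local Open Scope classical_set_scope.
Local Open Scope ring_scope.

Fixpoint iterD (R : realType) (V W : normedModType R) (vs : seq V) (F : V -> W)
  : V -> W :=
  match vs with
  | [::] => F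
  | v :: vs' => fun x => derive (iterD vs' F) x v
  end.

Definition smooth_on (R : realType) (V W : normedModType R) (U : set V)
  (F : V -> W) : Prop :=
  forall (vs : seq V) (x : V), U x ->
    {for x, continuous (iterD vs F)} /\ (forall v : V, derivable (iterD vs F) x v).

Definition loc_diffeo (R : realType) (n : nat) (phi : 'rV[R]_n -> 'rV[R]_n)
  (a : 'rV[R]_n) : Prop :=
  exists (U V : set 'rV[R]_n) (psi : 'rV[R]_n -> 'rV[R]_n),
    [/\ open U /\ U a, open V /\ smooth_on U phi, smooth_on V psi,
        (forall x, U x -> V (phi x) /\ psi (phi x) = x) &
        (forall y, V y -> U (psi y) /\ phi (psi y) = y)].

Definition A_equiv (R : realType) (f h : 'rV[R]_2 -> 'rV[R]_3) (p q : 'rV[R]_2)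
  : Prop :=
  exists (phi : 'rV[R]_2 -> 'rV[R]_2) (Phi : 'rV[R]_3 -> 'rV[R]_3),
    [/\ loc_diffeo phi p, phi p = q, loc_diffeo Phi (f p), Phi (f p) = h q &
        \forall x \near p, Phi (f x) = h (phi x)].

Definition row3 (R : realType) (a b c : R) : 'rV[R]_3 :=
  \row_(j < 3) [:: a; b; c]`_j.

Definition rows3 (R : realType) (a b c : 'rV[R]_3) : 'M[R]_3 :=
  \matrix_(i < 3, j < 3) [:: a 0 j; b 0 j; c 0 j]`_i.

Definition e_u (R : realType) : 'rV[R]_2 := delta_mx 0 0.
Definition e_v (R : realType) : 'rV[R]_2 := delta_mx 0 1.

Definition jac (R : realType) (m : nat) (F : 'rV[R]_2 -> 'rV[R]_m) (x : 'rV[R]_2)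
  : 'M[R]_(1 + 1, m) :=
  col_mx (derive F x (e_u R)) (derive F x (e_v R)).

Definition immersion_at (R : realType) (m : nat) (F : 'rV[R]_2 -> 'rV[R]_m)
  (x : 'rV[R]_2) : Prop := \rank (jac F x) = 2%N.

Definition cusp25 (R : realType) (x : 'rV[R]_2) : 'rV[R]_3 :=
  row3 (x 0 0) (x 0 1 ^+ 2) (x 0 1 ^+ 5).

Definition unit_normal (R : realType) (g1 g2 : R -> R) (x : 'rV[R]_2) : 'rV[R]_3 :=
  let a := g1 (x 0 0) in let b := g2 (x 0 1) in
  (Num.sqrt ((1 - a * b) ^+ 2 + 2 * (a + b) ^+ 2))^-1 *:
    row3 (a + b) (- a + b) (1 + a * b).

Definition lambda_fn (R : realType) (f : 'rV[R]_2 -> 'rV[R]_3) (g1 g2 : R -> R)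
  (x : 'rV[R]_2) : R :=
  \det (rows3 (derive f x (e_u R)) (derive f x (e_v R)) (unit_normal g1 g2 x)).

Definition front_at (R : realType) (f : 'rV[R]_2 -> 'rV[R]_3) (g1 g2 : R -> R)
  (p : 'rV[R]_2) : Prop :=
  \rank (row_mx (jac f p) (jac (unit_normal g1 g2) p)) = 2%N.

(* Main.v *)
(** Since [f = alpha u + beta v], everything is decided by the curve [beta], whose
    velocity is [w2 / 2] times a curve on the null cone.  Nondegeneracy gives
    [w2' <> 0 = w2] at [p], and failing to be a front means [g2' = 0] there.  The
    Moebius substitution [v - v0 = s / (1 - tau s)] with [tau = - w2'' / (6 w2')]
    removes the [s] and [s^3] terms of [beta], so Whitney's even-odd decomposition
    (Borel's theorem for the Taylor series, a direct argument for the flat remainder)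
    yields [beta = E(s^2) + s^5 D(s^2)].  Hence [f] is [Psi] composed with the
    (2,5)-cuspidal edge, where [Psi(z, X, Y) = alpha z + E X + Y D X].  The Jacobian of
    [Psi] is a nonzero multiple of [w2' g2''' - w2'' g2''], so if this number does not
    vanish, the inverse function theorem provides the target diffeomorphism.

    Conversely, if it vanishes, the curve [v - v0 = T(s) = s + tau s^2 + tau4 s^4]
    satisfies [beta (T s) - beta (T (- s)) = O(s^6)].  Let [Phi o f = cusp25 o phi] and
    let [S] be the second component of [phi] along the curve.  [Phi] is Lipschitz, so
    [S(T s)^5 - S(T (- s))^5 = O(s^6)], which contradicts [S t = m t + O(t^2)], where
    [m <> 0] because [phi] is a diffeomorphism whose first component is [O(t^2)]. *)

(* With [c = g2 - g2 v0] the null direction is exactly [q0 + c q1 + c^2 q2] for constant vectors.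
   Since [c] vanishes to order 2 and [w2] to order 1, [beta] moves along [q0] alone up to order 3;
   [q1] enters at order 4, and [q2] only beyond order 5. Hence the cubic term is parallel to the
   quadratic one, and this is why a reparametrization can remove it. At order 5 the component along
   [q0] is harmless and the one along [q1] decides. For the normal form the substitution must be
   inverted: the inverse of a Moebius map is again a Moebius map, so the source diffeomorphism is
   explicit. In the converse the curve is never inverted, so a polynomial serves; its coefficient
   [tau4] absorbs the [q0]-part at order 5, which the normal form may keep. The converse compares
   orders of vanishing at two parameter values and uses [Phi] only through a Lipschitz bound, so no
   jets of composite maps are computed. *)
Require Import Defs.
From HB Require Import structures.
From mathcomp Require Import all_boot all_order all_algebra.
From mathcomp Require Import all_classical all_reals all_analysis.
From mathcomp Require Import ring lra.
Import Order.TTheory GRing.Theory Num.Theory.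
Import numFieldNormedType.Exports.
Local Open Scope classical_set_scope.
Local Open Scope ring_scope.

Set Implicit Arguments. Unset Strict Implicit. Unset Printing Implicit Defensive.

(** * Functions of class C^k *)

Section differentiable_eps.
Context {R : realType} {V W : normedModType R}.

Lemma differentiable_eps (f : V -> W) x (L : {linear V -> W}) : continuous L ->
  (forall e, 0 < e -> \forall h \near 0, `|f (h + x) - f x - L h| <= e * `|h|) ->
  differentiable f x /\ 'd f x = L :> (V -> W).
Proof.
move=> Lc fx.
have fxL : f \o shift x = cst (f x) + L +o_ 0 id.
  apply/eqaddoP => e e0.
  near=> h; rewrite !fctE /= opprD addrA; near: h; exact: fx.
have E := diff_unique Lc fxL; split => //.
by apply/diff_locallyP; rewrite E.
Unshelve. all: by end_near. Qed.

Lemma differentiable_epsE (f : V -> W) x : differentiable f x ->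
  forall e, 0 < e -> \forall h \near 0, `|f (h + x) - f x - 'd f x h| <= e * `|h|.
Proof.
move=> /diff_locallyP [_ /eqaddoP H] e e0.
near=> h; have : `|(f \o shift x - (cst (f x) + 'd f x)) h| <= e * `|id h|.
  by near: h; exact: H.
by rewrite !fctE /= opprD addrA.
Unshelve. all: by end_near. Qed.

Lemma near_eq_differentiable (f g : V -> W) x :
  (\forall y \near x, f y = g y) -> differentiable f x -> differentiable g x.
Proof.
move=> fg df.
have fgx : f x = g x by exact: nbhs_singleton fg.
apply: (proj1 (@differentiable_eps g x ('d f x) _ _)).
  exact: diff_continuous.
move=> e /(differentiable_epsE df) H.
have fg' : \forall h \near 0, f (h + x) = g (h + x).
  by have := fg; rewrite (near_shift 0) /=; apply: filterS => h; rewrite subr0.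
by near=> h; rewrite -fgx -(near fg' h)//; near: h.
Unshelve. all: by end_near. Qed.

End differentiable_eps.

(** Order 0 asks nothing, so [Ck k] is k-fold Frechet differentiability without continuity of the
    last derivative; at [Cinf] the difference disappears. Frechet rather than directional
    derivatives are taken in order to have the chain rule. *)
Fixpoint Ck (R : realType) (V : normedModType R) (k : nat) (U : set V)
  (F : V -> R) : Prop :=
  if k is k'.+1 then
    (forall x, U x -> differentiable F x) /\ forall v, Ck k' U ('D_v F)
  else True.

Definition Cinf (R : realType) (V : normedModType R) (U : set V) (F : V -> R) :=
  forall k, Ck k U F.

Section Ck_theory.
Context {R : realType} {V : normedModType R}.
Implicit Types (U : set V) (F G : V -> R) (k : nat).

Lemma CkS k U F : Ck k.+1 U F -> Ck k U F.
Proof.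
elim: k F => [//|k IH] F [dF DF]; split=> // v.
by apply: IH; exact: DF.
Qed.

Lemma Ck_sub k U U' F : U' `<=` U -> Ck k U F -> Ck k U' F.
Proof.
move=> sub; elim: k F => [//|k IH] F [dF DF]; split=> [x /sub|v]; first exact: dF.
exact/IH/DF.
Qed.

(** On an open set, agreement of functions passes to their derivatives. The closure rules below use
    this to replace a derivative by the expression that a rule of calculus gives for it. *)
Lemma Ck_eq k U F G : open U -> (forall x, U x -> F x = G x) ->
  Ck k U F -> Ck k U G.
Proof.
move=> oU; elim: k F G => [//|k IH] F G FG [dF DF].
have nFG x : U x -> \near x, F x = G x.
  by move=> Ux; apply: filterS (open_nbhs_nbhs (conj oU Ux)) => y /FG.
split=> [x Ux|v]; first by apply: near_eq_differentiable (nFG _ Ux) (dF _ Ux).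
apply: IH (DF v) => x Ux; exact/near_eq_derive/nFG.
Qed.

Lemma Ck_cst k U (c : R) : Ck k U (fun=> c).
Proof.
elim: k c => [//|k IH] c; split=> [x _|v]; first exact: differentiable_cst.
rewrite (_ : 'D_v _ = fun=> 0)//; apply/funext => x; exact: derive_cst.
Qed.

Lemma CkD k U F G : open U -> Ck k U F -> Ck k U G -> Ck k U (fun x => F x + G x).
Proof.
move=> oU; elim: k F G => [//|k IH] F G [dF DF] [dG DG]; split=> [x Ux|v].
  by apply: differentiableD; [exact: dF|exact: dG].
apply: Ck_eq (IH _ _ (DF v) (DG v)) => // x Ux.
by rewrite deriveD //; apply: diff_derivable; [exact: dF|exact: dG].
Qed.

Lemma CkM k U F G : open U -> Ck k U F -> Ck k U G -> Ck k U (fun x => F x * G x).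
Proof.
move=> oU; elim: k F G => [//|k IH] F G [dF DF] [dG DG]; split=> [x Ux|v].
  by apply: differentiableM; [exact: dF|exact: dG].
have := CkD oU (IH _ _ (CkS (conj dF DF)) (DG v)) (IH _ _ (CkS (conj dG DG)) (DF v)).
apply: Ck_eq => // x Ux.
by rewrite deriveM //; apply: diff_derivable; [exact: dF|exact: dG].
Qed.

Lemma CkZ k U (c : R) F : open U -> Ck k U F -> Ck k U (fun x => c * F x).
Proof. by move=> oU; apply: CkM => //; exact: Ck_cst. Qed.

Lemma CkB k U F G : open U -> Ck k U F -> Ck k U G -> Ck k U (fun x => F x - G x).
Proof.
move=> oU CF CG; apply: (@Ck_eq _ _ (fun x => F x + (-1) * G x)) => //.
  by move=> x _; rewrite mulN1r.
by apply: CkD => //; exact: CkZ.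
Qed.

Lemma Ck_sum k U (I : Type) (s : seq I) (P : pred I) (F : I -> V -> R) : open U ->
  (forall i, P i -> Ck k U (F i)) -> Ck k U (fun x => \sum_(i <- s | P i) F i x).
Proof.
move=> oU CF; elim: s => [|i s IH].
  by apply: Ck_eq (Ck_cst k U 0) => // x _; rewrite big_nil.
case Pi : (P i); last by apply: Ck_eq IH => // x _; rewrite big_cons Pi.
by apply: Ck_eq (CkD oU (CF i Pi) IH) => // x _; rewrite big_cons Pi.
Qed.

Lemma Ck_prod k U (I : Type) (s : seq I) (P : pred I) (F : I -> V -> R) : open U ->
  (forall i, P i -> Ck k U (F i)) -> Ck k U (fun x => \prod_(i <- s | P i) F i x).
Proof.
move=> oU CF; elim: s => [|i s IH].
  by apply: Ck_eq (Ck_cst k U 1) => // x _; rewrite big_nil.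
case Pi : (P i); last by apply: Ck_eq IH => // x _; rewrite big_cons Pi.
by apply: Ck_eq (CkM oU (CF i Pi) IH) => // x _; rewrite big_cons Pi.
Qed.

Lemma CkX k U F n : open U -> Ck k U F -> Ck k U (fun x => F x ^+ n).
Proof.
move=> oU CF; elim: n => [|n IH]; first exact: Ck_cst.
by apply: Ck_eq (CkM oU CF IH) => // x _; rewrite exprS.
Qed.

(** In the chain rule the outer map [h] is replaced by its derivative, one order lower, hence the
    induction over all [h]. *)
Lemma Ck_comp1 k U (J : set R) F (h : R -> R) : open U -> Ck k J h -> Ck k U F ->
  (forall x, U x -> J (F x)) -> Ck k U (fun x => h (F x)).
Proof.
move=> oU; elim: k F h => [//|k IH] F h Ch CF FJ.
have [dh Dh] := Ch; have [dF DF] := CF.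
split=> [x Ux|v].
  by apply: differentiable_comp; [exact: dF|exact/dh/FJ].
have C1 := IH _ _ (Dh 1) (CkS CF) FJ.
apply: Ck_eq (CkM oU C1 (DF v)) => // x Ux.
have dhF := dh _ (FJ _ Ux); have dFx := dF _ Ux.
rewrite [RHS]deriveE; last exact: differentiable_comp.
rewrite diff_comp //= !deriveE //.
by rewrite -[in RHS](mulr1 ('d F x v)) [RHS]linearZ/= mulrC.
Qed.

Lemma CkV k U F : open U -> (forall x, U x -> F x != 0) -> Ck k U F ->
  Ck k U (fun x => (F x)^-1).
Proof.
move=> oU F0; elim: k F F0 => [//|k IH] F F0 CF; have [dF DF] := CF.
split=> [x Ux|v]; first by apply: differentiableV; [exact: dF|exact: F0].
have := CkZ (-1) oU (CkM oU (CkX 2 oU (IH F F0 (CkS CF))) (DF v)).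
apply: Ck_eq => // x Ux.
rewrite deriveV ?F0 //; last exact/diff_derivable/dF.
by rewrite exprVn mulN1r scaleNr.
Qed.

Lemma Cinf_derive U F v : Cinf U F -> Cinf U ('D_v F).
Proof. by move=> CF k; have [_] := CF k.+1; apply. Qed.

Lemma Cinf_differentiable U F x : Cinf U F -> U x -> differentiable F x.
Proof. by move=> CF; have [+ _] := CF 1%N; apply. Qed.

Lemma Cinf_iterD U F (vs : seq V) : Cinf U F -> Cinf U (Defs.iterD vs F).
Proof. by elim: vs => //= v vs IH /IH; exact: Cinf_derive. Qed.

End Ck_theory.

Lemma smooth_on_Cinf (R : realType) (U : set R) (F : R -> R) :
  smooth_on U F -> Cinf U F.
Proof.
move=> sF k; rewrite -[F]/(Defs.iterD [::] F).
(* All iterated derivatives are treated at once, because deriving [iterD vs F] gives [iterD] of a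
   longer list. *)
elim: k [::] => [//|k IH] vs; split=> [x Ux|v]; last exact: (IH (v :: vs)).
by apply/derivable1_diffP; have [_] := sF vs x Ux; apply.
Qed.

Lemma derive_coord (R : realType) n (v : 'rV[R]_n) (i : 'I_n) :
  'D_v (fun x : 'rV[R]_n => x 0 i) = fun=> v 0 i.
Proof.
apply/funext => x; apply/cvg_lim => //.
apply: (cvg_trans _ (@cvg_cst _ (v 0 i) _ 0^' _)).
apply: near_eq_cvg; near=> h; rewrite /= !mxE addrK.
by rewrite /GRing.scale /= mulKf//; near: h; exact: nbhs_dnbhs_neq.
Unshelve. all: by end_near. Qed.

Lemma Ck_coord (R : realType) n k (U : set 'rV[R]_n) (i : 'I_n) :
  Ck k U (fun x : 'rV[R]_n => x 0 i).
Proof.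
case: k => [//|k]; split=> [x _|v]; first exact: differentiable_coord.
by rewrite derive_coord; exact: Ck_cst.
Qed.

(** * Mean value and Lipschitz estimates *)

Lemma entry_le_norm (R : realType) m n (A : 'M[R]_(m, n)) i j : `|A i j| <= `|A|.
Proof. by rewrite [leRHS]/Num.Def.normr /= mx_normrE; exact: (le_bigmax _ _ (i, j)). Qed.

Lemma norm_le_entries (R : realType) m n (A : 'M[R]_(m, n)) e : 0 <= e ->
  (forall i j, `|A i j| <= e) -> `|A| <= e.
Proof.
move=> e0 Ae; rewrite [leLHS]/Num.Def.normr /= mx_normrE.
by apply: bigmax_le => // -[i j] _; exact: Ae.
Qed.

Lemma smooth_on_rV (R : realType) (V : normedModType R) n (U : set V)
    (F : V -> 'rV[R]_n) :
  open U -> (forall j, Cinf U (fun x => F x 0 j)) -> smooth_on U F.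
Proof.
move=> oU CF vs.
have H ws : forall x, U x -> forall j, Defs.iterD ws F x 0 j =
    Defs.iterD ws (fun x => F x 0 j) x.
  elim: ws => [//|w ws IH] x Ux j.
  have nE i : \near x, Defs.iterD ws (fun x => F x 0 i) x = Defs.iterD ws F x 0 i.
    by apply: filterS (open_nbhs_nbhs (conj oU Ux)) => y /IH.
  have dF : derivable (Defs.iterD ws F) x w.
    apply/derivable_mxP => i k; rewrite ord1.
    apply: near_eq_derivable (nE k) _; apply: diff_derivable.
    by apply: Cinf_differentiable Ux; exact: Cinf_iterD.
  by rewrite /= derive_mx // !mxE; apply/esym/near_eq_derive.
move=> x Ux; split.
  apply/cvgrPdist_le => e e0.
  suff : \forall t \near x, forall j : 'I_n,
      `|Defs.iterD vs F x 0 j - Defs.iterD vs F t 0 j| <= e.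
    apply: filterS => t Ht; apply: norm_le_entries (ltW e0) _ => i j.
    by rewrite !mxE ord1; exact: Ht.
  apply: filter_forall => j.
  have cF : {for x, continuous (Defs.iterD vs (fun x => F x 0 j))}.
    apply/differentiable_continuous.
    by apply: Cinf_differentiable Ux; exact: Cinf_iterD.
  near=> t; rewrite !H//; last by near: t; exact: open_nbhs_nbhs.
  near: t; exact: (cvgrPdist_le _ _).1 cF e e0.
move=> v; apply/derivable_mxP => i j; rewrite ord1.
apply: (@near_eq_derivable _ _ _ (Defs.iterD vs (fun x => F x 0 j))).
  by apply: filterS (open_nbhs_nbhs (conj oU Ux)) => y /H ->.
by apply: diff_derivable; apply: Cinf_differentiable Ux; exact: Cinf_iterD.
Unshelve. all: by end_near. Qed.

Lemma mean_value_bound (R : realType) (f df : R -> R) (a b M : R) :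
  (forall t, Num.min a b <= t <= Num.max a b -> is_derive t 1 f (df t)) ->
  (forall t, Num.min a b <= t <= Num.max a b -> `|df t| <= M) ->
  `|f b - f a| <= M * `|b - a|.
Proof.
wlog ab : a b / a <= b => [W|].
  case: (orP (le_total a b)) => ab; first exact: W.
  by rewrite minC maxC => ? ?; rewrite distrC (distrC b); exact: W.
rewrite min_l // max_r // => Df dfM.
have [x||c] := @MVT_segment _ f df a b ab.
- by rewrite in_itv /= => /andP[/ltW ? /ltW ?]; apply: Df; apply/andP.
- apply: derivable_within_continuous => x; rewrite in_itv /= => /Df.
  by case.
- by rewrite in_itv /= => /dfM cM ->; rewrite normrM ler_wpM2r.
Qed.

(** Derivability along [e] alone suffices, because the restriction only sees points of the line. *)
Lemma is_derive_line (R : realType) (V W : normedModType R) (F : V -> W) (w e : V) t :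
  derivable F (w + t *: e) e ->
  is_derive t 1 (fun t => F (w + t *: e)) ('D_e F (w + t *: e)).
Proof.
have E : (fun h => h^-1 *: (((fun t => F (w + t *: e)) \o shift t) (h *: 1) -
      F (w + t *: e))) =
    (fun h => h^-1 *: ((F \o shift (w + t *: e)) (h *: e) - F (w + t *: e))).
  apply/funext => h /=; congr (_ *: (F _ - _)).
  by rewrite scalerDl [h *: 1]mulr1 addrCA.
by move=> dF; split; rewrite /derivable /derive E.
Qed.

Lemma norm_lt_entries (R : realType) m n (A : 'M[R]_(m, n)) e : 0 < e ->
  (forall i j, `|A i j| < e) -> `|A| < e.
Proof.
move=> e0 Ae; rewrite [ltLHS]/Num.Def.normr /= mx_normrE.
by apply/bigmax_ltP; split=> // -[i j] _; exact: Ae.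
Qed.

(** * Neighbourhoods as balls of the norm *)

Section balls.
Context {R : realType} {V : normedModType R}.

Lemma near_norm (a : V) (P : V -> Prop) :
  (\forall x \near a, P x) <-> exists2 r, 0 < r & forall x, `|x - a| < r -> P x.
Proof.
split=> [/nbhs_ballP [r /= r0 rP]|[r r0 rP]]; last first.
  by apply/nbhs_ballP; exists r => //= x; rewrite -ball_normE /= distrC => /rP.
by exists r => // x xa; apply: rP; rewrite -ball_normE /= distrC.
Qed.

Lemma continuous_norm (W : normedModType R) (f : V -> W) a :
  {for a, continuous f} ->
  forall e, 0 < e -> exists2 r, 0 < r & forall x, `|x - a| < r -> `|f x - f a| <= e.
Proof.
move=> /cvgrPdist_le c e e0; apply/near_norm; move: (c e e0).
by apply: filterS => x; rewrite distrC.
Qed.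

Lemma open_norm (U : set V) a : open U -> U a ->
  exists2 r, 0 < r & forall x, `|x - a| < r -> U x.
Proof. by move=> oU Ua; apply/near_norm; exact: open_nbhs_nbhs. Qed.

Lemma norm_open (U : set V) :
  (forall a, U a -> exists2 r, 0 < r & forall x, `|x - a| < r -> U x) -> open U.
Proof. by move=> H; rewrite openE => a /H /near_norm. Qed.

Lemma common_radius (I : finType) (a : V) (P : I -> V -> Prop) :
  (forall i, exists2 r, 0 < r & forall x, `|x - a| < r -> P i x) ->
  exists2 r, 0 < r & forall x, `|x - a| < r -> forall i, P i x.
Proof.
by move=> H; apply/near_norm; apply: filter_forall => i; apply/near_norm.
Qed.

Lemma near_norm2 (a : V) (P Q : V -> Prop) :
  (exists2 r, 0 < r & forall x, `|x - a| < r -> P x) ->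
  (exists2 r, 0 < r & forall x, `|x - a| < r -> Q x) ->
  exists2 r, 0 < r & forall x, `|x - a| < r -> P x /\ Q x.
Proof. by move=> /near_norm aP /near_norm aQ; apply/near_norm; exact: filterI. Qed.

End balls.

(* Successive replacement of coordinates: unlike the segment from [x] to [y], this
   needs only partial derivatives; the path stays in the ball of the sup norm. *)
Lemma partials_lipschitz (R : realType) n (F : 'rV[R]_n -> R) a r (M : R) :
  (forall x, `|x - a| < r -> forall i, derivable F x (delta_mx 0 i) /\
     `|'D_(delta_mx 0 i) F x| <= M) ->
  forall x y, `|x - a| < r -> `|y - a| < r -> `|F y - F x| <= n%:R * M * `|y - x|.
Proof.
move=> dF x y ax ay.
have [n0|n0] := posnP n.
  subst n; rewrite !mul0r (_ : y = x) ?subrr ?normr0//.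
  by apply/rowP => -[].
have M0 : 0 <= M by have [_] := dF x ax (Ordinal n0); exact: le_trans.
pose z k : 'rV[R]_n := \row_i if (i < k)%N then y 0 i else x 0 i.
suff : forall k, (k <= n)%N -> `|F (z k) - F x| <= k%:R * M * `|y - x|.
  move=> /(_ n (leqnn n)); suff -> : z n = y by [].
  by apply/rowP => i; rewrite mxE ltn_ord.
elim=> [_|k IH kn].
  rewrite !mul0r (_ : z 0%N = x) ?subrr ?normr0//.
  by apply/rowP => i; rewrite mxE.
rewrite -(subrKA (F (z k))) (le_trans (ler_normD _ _))//.
rewrite -natr1 !mulrDl mul1r [leLHS]addrC lerD ?IH ?(ltnW kn)//.
pose o := Ordinal kn; pose e := delta_mx 0 o : 'rV[R]_n.
have zE : z k.+1 = z k + (y 0 o - x 0 o) *: e.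
  apply/rowP => i; rewrite !mxE eqxx /= ltnS leq_eqVlt.
  have [->|io] := eqVneq i o; first by rewrite /= eqxx ltnn mulr1 subrKC.
  by rewrite (negPf (io : (i : nat) != k)) /= mulr0 addr0.
have z0 : z k = z k + 0 *: e by rewrite scale0r addr0.
have bz t : Num.min 0 (y 0 o - x 0 o) <= t <= Num.max 0 (y 0 o - x 0 o) ->
    `|z k + t *: e - a| < r.
  move=> /andP[t1 t2]; apply: norm_lt_entries => [|i j].
    exact: le_lt_trans ax.
  have {}ax : `|x 0 j - a 0 j| < r.
    by apply: le_lt_trans ax; have := entry_le_norm (x - a) 0 j; rewrite !mxE.
  have {}ay : `|y 0 j - a 0 j| < r.
    by apply: le_lt_trans ay; have := entry_le_norm (y - a) 0 j; rewrite !mxE.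
  rewrite !ord1 !mxE eqxx /=.
  have [jo|jo] := eqVneq j o; last by rewrite mulr0 addr0; case: ifP.
  rewrite jo ltnn mulr1; rewrite jo in ax ay.
  move: t1 t2 ax ay; rewrite !ltr_distl.
  by case: (leP 0 (y 0 o - x 0 o)) => H ? ? /andP[? ?] /andP[? ?]; apply/andP; split; lra.
rewrite zE [X in _ - F X]z0.
apply: le_trans (mean_value_bound (f := fun t => F (z k + t *: e))
  (df := fun t => 'D_e F (z k + t *: e)) (M := M) _ _) _.
- by move=> t /bz /dF /(_ o) [+ _]; exact: is_derive_line.
- by move=> t /bz /dF /(_ o) [].
- rewrite subr0 ler_wpM2l//; have := entry_le_norm (y - x) 0 o.
  by rewrite !mxE.
Qed.

Lemma smooth_on_lipschitz (R : realType) n m (U : set 'rV[R]_n)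
    (F : 'rV[R]_n -> 'rV[R]_m) a :
  open U -> U a -> smooth_on U F ->
  exists L r, [/\ 0 < L, 0 < r & forall x y, `|x - a| < r -> `|y - a| < r ->
    `|F y - F x| <= L * `|y - x|].
Proof.
move=> oU Ua sF.
(* The summand 1 leaves room for the variation of the partial derivatives near [a]. *)
pose M := 1 + \sum_(i < n) `|'D_(delta_mx 0 i) F a|.
have Mi i : `|'D_(delta_mx 0 i) F a| + 1 <= M.
  by rewrite addrC lerD2l (bigD1 i) //= lerDl sumr_ge0.
have [|r r0 Hr] := near_norm2 (open_norm oU Ua) (@common_radius _ _ 'I_n a
   (fun i x => `|'D_(delta_mx 0 i) F x| <= M) _).
  move=> i; have [c _] := sF [:: delta_mx 0 i] a Ua.
  have [r r0 Hr] := continuous_norm c ltr01; exists r => // x /Hr Hx.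
  apply: le_trans (Mi i); rewrite -[X in `|X|](subrK ('D_(delta_mx 0 i) F a)).
  by rewrite (le_trans (ler_normD _ _))// addrC lerD2l.
(* Adding 1 keeps the constant positive when [n] is 0. *)
exists (n%:R * M + 1), r; have M0 : 0 <= M by rewrite addr_ge0 ?sumr_ge0.
split => //; first by rewrite ltr_wpDl// mulr_ge0.
move=> x y ax ay; apply: norm_le_entries => [|i j].
  by rewrite mulr_ge0 ?addr_ge0 ?mulr_ge0.
rewrite !mxE ord1.
apply: le_trans (partials_lipschitz (F := fun x => F x 0 j) (M := M) _ ax ay) _; last first.
  by rewrite ler_wpM2r // lerDl.
move=> z /Hr [Uz Mz] k.
have [_ /(_ (delta_mx 0 k)) dF] := sF [::] z Uz.
have /derivable_mxP/(_ 0 j) dFj := dF; split => //.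
apply: le_trans (Mz k).
by have := entry_le_norm ('D_(delta_mx 0 k) F z) 0 j; rewrite derive_mx // mxE.
Qed.

(** * The inverse function theorem *)

HB.instance Definition _ (R : realType) m n := Complete.on (matrix R m n).

Lemma contraction_fixed_point (R : realType) n (B : set 'rV[R]_n)
    (T : 'rV[R]_n -> 'rV[R]_n) :
  (forall x, B x -> B (T x)) -> closed B -> B !=set0 ->
  (forall x y, B x -> B y -> `|T x - T y| <= 2^-1 * `|x - y|) ->
  exists2 x, B x & x = T x.
Proof.
move=> BT cB B0 H.
have fT : isFun _ _ B B T by split.
pose f : {fun B >-> B} := HB.pack T fT.
have [] := @banach_fixed_point R _ B f _ cB B0; last by move=> x; exists x.
exists (2^-1%:nng : {nonneg R}); split; first by rewrite /= invf_lt1 // ltr1n.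
by move=> [x y] [Bx By]; apply: H.
Qed.

Lemma row_sum_scale (R : realType) n (x : 'rV[R]_n) :
  x = \sum_j x 0 j *: delta_mx 0 j.
Proof. exact: row_sum_delta. Qed.

(** * Chain rule in coordinates and smoothness of matrix operations *)

Section rV_calculus.
Context {R : realType} {V : normedModType R} {n : nat}.

Lemma differentiable_rV (F : V -> 'rV[R]_n) x :
  (forall j, differentiable (fun y => F y 0 j) x) -> differentiable F x.
Proof.
move=> dF; rewrite (_ : F = \sum_(j < n) (fun y => F y 0 j *: delta_mx 0 j)).
  by apply: differentiable_sum => j; exact: differentiableZl.
by apply/funext => y; rewrite fct_sumE; exact: row_sum_scale.
Qed.

Lemma derive_rV (F : V -> 'rV[R]_n) x v :
  (forall j, differentiable (fun y => F y 0 j) x) ->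
  'D_v F x = \row_j 'D_v (fun y => F y 0 j) x.
Proof.
move=> /differentiable_rV dF; rewrite derive_mx; last exact: diff_derivable.
by apply/rowP => j; rewrite !mxE.
Qed.

Lemma derive_coord_sum (K : 'rV[R]_n -> R) w h : differentiable K w ->
  'D_h K w = \sum_j h 0 j * 'D_(delta_mx 0 j) K w.
Proof.
move=> dK; rewrite deriveE // {1}[h]row_sum_scale linear_sum; apply: eq_bigr => j _.
by rewrite linearZ deriveE.
Qed.

Lemma derive_comp_rV (K : 'rV[R]_n -> R) (F : V -> 'rV[R]_n) x v :
  differentiable K (F x) -> (forall j, differentiable (fun y => F y 0 j) x) ->
  'D_v (fun y => K (F y)) x =
  \sum_j 'D_v (fun y => F y 0 j) x * 'D_(delta_mx 0 j) K (F x).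
Proof.
move=> dK dFj; have dF := differentiable_rV dFj.
rewrite deriveE; last exact: differentiable_comp.
rewrite diff_comp //= -!deriveE // derive_coord_sum //.
by apply: eq_bigr => j _; rewrite derive_rV // mxE.
Qed.

Lemma Ck_comp_rV k (U : set V) (U' : set 'rV[R]_n) (K : 'rV[R]_n -> R)
    (F : V -> 'rV[R]_n) : open U -> Ck k U' K ->
  (forall j, Ck k U (fun y => F y 0 j)) -> (forall x, U x -> U' (F x)) ->
  Ck k U (fun y => K (F y)).
Proof.
move=> oU; elim: k K => [//|k IH] K CK CF UF; have [dK DK] := CK.
have dF x j : U x -> differentiable (fun y => F y 0 j) x by move=> Ux; apply: (CF j).1.
split=> [x Ux|v].
  apply: differentiable_comp; last exact/dK/UF.
  by apply: differentiable_rV => j; exact: dF.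
have CFk j := CkS (CF j).
apply: (@Ck_eq _ _ _ _ (fun x => \sum_j
    'D_v (fun y => F y 0 j) x * 'D_(delta_mx 0 j) K (F x))) => //.
  by move=> x Ux; rewrite derive_comp_rV //; [exact/dK/UF|move=> j; exact: dF].
apply: Ck_sum => // j _; apply: CkM => //; first exact: (CF j).2.
exact: (IH _ (DK (delta_mx 0 j)) CFk UF).
Qed.

Lemma Ck_det k (U : set V) m (A : V -> 'M[R]_m) : open U ->
  (forall i j, Ck k U (fun x => A x i j)) -> Ck k U (fun x => \det (A x)).
Proof.
move=> oU CA; rewrite /determinant; apply: Ck_sum => // s _; apply: CkZ => //.
exact: Ck_prod.
Qed.

End rV_calculus.

(** Cramer's rule: each entry of the inverse is a cofactor divided by the determinant. *)
Lemma Ck_invmx (R : realType) (V : normedModType R) k (U : set V) m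
    (A : V -> 'M[R]_m) i j : open U ->
  (forall i j, Ck k U (fun x => A x i j)) -> (forall x, U x -> \det (A x) != 0) ->
  Ck k U (fun x => invmx (A x) i j).
Proof.
move=> oU CA A0.
apply: (@Ck_eq _ _ _ _ (fun x => (\det (A x))^-1 *
    ((-1) ^+ (j + i) * \det (row' j (col' i (A x)))))) => //.
  by move=> x /A0 Ax; rewrite /invmx unitmxE unitfE Ax !mxE.
apply: CkM => //; first by apply: CkV => //; exact: Ck_det.
apply: CkZ => //; apply: Ck_det => // p q.
by apply: Ck_eq (CA (lift j p) (lift i q)) => // x _; rewrite !mxE.
Qed.

(** The transpose of the usual Jacobian matrix: rows are directions, so that it acts on row vectors
    from the right. *)
Definition partials (R : realType) n (F : 'rV[R]_n -> 'rV[R]_n) (x : 'rV[R]_n) :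
  'M[R]_n := \matrix_(i, j) 'D_(delta_mx 0 i) (fun y => F y 0 j) x.

Lemma derive_partials (R : realType) n (F : 'rV[R]_n -> 'rV[R]_n) x h :
  (forall j, differentiable (fun y => F y 0 j) x) -> 'D_h F x = h *m partials F x.
Proof.
move=> dF; rewrite derive_rV //; apply/rowP => j; rewrite !mxE derive_coord_sum //.
by apply: eq_bigr => i _; rewrite mxE.
Qed.

Lemma norm_mulmx_le (R : realType) m n (L : 'M[R]_(m, n)) :
  exists2 c, 0 < c & forall y : 'rV[R]_m, `|y *m L| <= c * `|y|.
Proof.
exists (1 + \sum_i \sum_j `|L i j|).
  by rewrite ltr_pwDl// sumr_ge0 // => i _; rewrite sumr_ge0.
move=> y; apply: norm_le_entries => [|i j].
  by rewrite mulr_ge0 // addr_ge0 // sumr_ge0 // => i _; rewrite sumr_ge0.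
rewrite !mxE ord1; apply: (@le_trans _ _ (\sum_i `|y 0 i| * `|L i j|)).
  by apply: (le_trans (ler_norm_sum _ _ _)); apply: ler_sum => k _; rewrite normrM.
rewrite mulrDl mul1r ler_wpDl // mulr_suml; apply: ler_sum => k _.
rewrite mulrC; apply: ler_pM => //; last exact: entry_le_norm.
by rewrite (bigD1 j) //= lerDl sumr_ge0.
Qed.

(** * Regularity of a Lipschitz right inverse *)

Section inverse_function.
Context {R : realType} {n : nat}.
Variables (F : 'rV[R]_n -> 'rV[R]_n) (U V : set 'rV[R]_n) (c : R)
  (G : 'rV[R]_n -> 'rV[R]_n).
Hypotheses (c0 : 0 < c) (oU : open U) (oV : open V)
  (CF : forall j, Cinf U (fun x => F x 0 j))
  (F0 : forall x, U x -> \det (partials F x) != 0)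
  (VG : forall y, V y -> U (G y)) (FG : forall y, V y -> F (G y) = y)
  (lipG : forall y z, V y -> V z -> `|G z - G y| <= c * `|z - y|).

(** Put [k = G (h + y) - G y] and let [N] be the inverse matrix. Then [h = F (x + k) - F x] differs
    from [k *m partials F x] by o(k), and [k - h *m N] is the image of this error under [- N]. The
    Lipschitz bound on [G] turns o(k) into o(h). *)
Lemma right_inverse_differentiable y : V y ->
  differentiable G y /\
  'd G y = mulmxr (invmx (partials F (G y))) :> ('rV[R]_n -> 'rV[R]_n).
Proof.
move=> Vy; set x := G y; set N := invmx _; have Ux : U x by exact: VG.
have dF j : differentiable (fun z => F z 0 j) x.
  exact: Cinf_differentiable (CF j) Ux.
have [d d0 Nd] := norm_mulmx_le N.
pose L : {linear 'rV[R]_n -> 'rV[R]_n} := mulmxr N.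
apply: (@differentiable_eps _ _ _ G y L).
  apply/(linear_bounded_continuous L).
  have [d' _ Nd'] := norm_mulmx_le N.
  apply/linear_boundedP; exists `|d'|; split; first exact: num_real.
  move=> q d'q z; apply: le_trans (Nd' z) _; rewrite ler_wpM2r //.
  by apply: le_trans (ler_norm _) (ltW d'q).
move=> e e0.
(* The error is multiplied by at most [d] through [N] and by [c] in passing from [k] to [h]. *)
pose e' := e / (d * c); have e'0 : 0 < e' by rewrite divr_gt0 // mulr_gt0.
have [r r0 Hr] := (near_norm _ _).1 (differentiable_epsE (differentiable_rV dF) e'0).
have [s s0 Hs] := open_norm oV Vy.
apply/near_norm; exists (Num.min s (r / c)).
  by rewrite lt_min s0 divr_gt0.
move=> h; rewrite subr0 lt_min => /andP[hs hr].
have Vh : V (h + y) by apply: Hs; rewrite addrK.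
pose k := G (h + y) - x.
have kc : `|k| <= c * `|h| by rewrite (le_trans (lipG Vy Vh)) // addrK.
have kr : `|k| < r.
  by rewrite (le_lt_trans kc)// mulrC -ltr_pdivlMr.
have := Hr k; rewrite subr0 => /(_ kr).
rewrite -deriveE; last exact: differentiable_rV.
rewrite derive_partials // /k subrK FG // FG // addrK -/k => Hk.
have -> : k - h *m N = - ((h - k *m partials F x) *m N).
  rewrite mulmxBl -mulmxA mulmxV ?mulmx1 ?opprB //.
  by rewrite unitmxE unitfE F0.
rewrite normrN (le_trans (Nd _)) // (le_trans (ler_wpM2l (ltW d0) Hk)) //.
rewrite (le_trans (ler_wpM2l (ltW d0) (ler_wpM2l (ltW e'0) kc))) //.
rewrite !mulrA ler_wpM2r // /e' invfM !mulrA.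
by rewrite le_eqVlt; apply/orP; left; apply/eqP; field; rewrite !gt_eqF.
Qed.

(** Bootstrapping: the derivative of [G] is the inverse matrix of [partials F] at [G y], so it is as
    regular as [G], and [G] gains one order. *)
Lemma right_inverse_smooth j : Cinf V (fun y => G y 0 j).
Proof.
have dG y i : V y -> differentiable (fun y => G y 0 i) y.
  move=> Vy; apply: (@differentiable_comp _ _ _ _ G (fun z => z 0 i)).
    by have [] := right_inverse_differentiable Vy.
  exact: differentiable_coord.
move=> k; elim: k j => [//|k IH] j; split=> [y Vy|v]; first exact: dG.
have Cinv i : Ck k V (fun y => invmx (partials F (G y)) i j).
  apply: (@Ck_comp_rV _ _ _ _ _ U (fun x => invmx (partials F x) i j)) => //.
  apply: Ck_invmx => // p q; apply: (@Ck_eq _ _ _ _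
    ('D_(delta_mx 0 p) (fun y => F y 0 q))) => //; first by move=> x _; rewrite mxE.
  exact: Cinf_derive.
apply: (@Ck_eq _ _ _ _
  (fun y => \sum_i v 0 i * invmx (partials F (G y)) i j)) => //.
  move=> y Vy; have [dGy DG] := right_inverse_differentiable Vy.
  transitivity (('D_v G y) 0 j); first by rewrite deriveE // DG /= !mxE.
  by rewrite derive_rV; [rewrite mxE|move=> i; exact: dG].
by apply: Ck_sum => // i _; apply: CkZ.
Qed.

End inverse_function.

Lemma Cinf_sub (R : realType) (V : normedModType R) (U U' : set V) (F : V -> R) :
  U' `<=` U -> Cinf U F -> Cinf U' F.
Proof. by move=> sub CF k; apply: Ck_sub (CF k). Qed.

Lemma Cinf_partial_continuous (R : realType) n (U : set 'rV[R]_n)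
    (K : 'rV[R]_n -> R) a v : Cinf U K -> U a -> {for a, continuous ('D_v K)}.
Proof.
move=> CK Ua; apply: differentiable_continuous.
exact: Cinf_differentiable (Cinf_derive v CK) Ua.
Qed.

Lemma closed_norm_ball (R : realType) n (a : 'rV[R]_n) r :
  closed [set x : 'rV[R]_n | `|x - a| <= r].
Proof.
rewrite (_ : [set _ | _] = (fun x => `|x - a|) @^-1` [set t | t <= r])//.
apply: closed_comp; last exact: closed_le.
move=> x _; apply: continuous_comp; last exact: norm_continuous.
by apply: continuousB; [exact: cvg_id|exact: cst_continuous].
Qed.

Theorem inverse_function (R : realType) n (U : set 'rV[R]_n)
    (F : 'rV[R]_n -> 'rV[R]_n) a :
  open U -> U a -> (forall j, Cinf U (fun x => F x 0 j)) ->
  \det (partials F a) != 0 ->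
  exists (U' V : set 'rV[R]_n) (G : 'rV[R]_n -> 'rV[R]_n),
    [/\ open U' /\ U' a, U' `<=` U, open V /\ V (F a),
        (forall j, Cinf V (fun y => G y 0 j)) &
        (forall x, U' x -> V (F x) /\ G (F x) = x) /\
        (forall y, V y -> U' (G y) /\ F (G y) = y)].
Proof.
move=> oU Ua CF Fa0; set L := invmx (partials F a).
(* Simplified Newton iteration: [F x = y] exactly when [x] is fixed by [H + y *m L], and the
   derivative of [H] vanishes at [a]. *)
pose H x : 'rV[R]_n := x - F x *m L.
have HE j : (fun x => H x 0 j) = fun x => x 0 j - \sum_i L i j * F x 0 i.
  apply/funext => x; rewrite !mxE; congr (_ - _); apply: eq_bigr => i _.
  by rewrite mulrC.
have CH j : Cinf U (fun x => H x 0 j).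
  move=> k; rewrite HE; apply: CkB => //; first exact: Ck_coord.
  by apply: Ck_sum => // i _; apply: CkZ => //; exact: CF.
have dF i : differentiable (fun x => F x 0 i) a by exact: Cinf_differentiable Ua.
have DH i j : 'D_(delta_mx 0 i) (fun x => H x 0 j) a = 0.
  have Fu : partials F a \in unitmx by rewrite unitmxE unitfE.
  pose Fk k (x : 'rV[R]_n) : R := F x 0 k; pose xj (x : 'rV[R]_n) : R := x 0 j.
  have -> : (fun x => H x 0 j) = xj - \sum_(k < n) (L k j *: Fk k).
    by rewrite HE; apply/funext => x; rewrite !fctE fct_sumE.
  rewrite deriveB; last 2 first.
  - exact/diff_derivable/differentiable_coord.
  - by apply: derivable_sum => k; apply: derivableZ; exact: diff_derivable (dF k).
  have -> : 'D_(delta_mx 0 i) xj a = (delta_mx 0 i : 'rV[R]_n) 0 j.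
    exact: (congr1 (@^~ a) (derive_coord (delta_mx 0 i) j)).
  rewrite derive_sum; last first.
    by move=> k; apply: derivableZ; exact: diff_derivable (dF k).
  have /matrixP/(_ i j) := mulmxV Fu; rewrite !mxE eqxx /= eq_sym => <-.
  apply/eqP; rewrite subr_eq0; apply/eqP; apply: eq_bigr => k _.
  by rewrite deriveZ ?mxE 1?mulrC //; exact: diff_derivable (dF k).
(* [partials_lipschitz] loses a factor [n]; this bound leaves the contraction ratio 1/2, and [n.+1]
   avoids dividing by 0. *)
pose M : R := (2 * n.+1%:R)^-1.
have M0 : 0 < M by rewrite invr_gt0 mulr_gt0.
have near1 : exists2 r, 0 < r & forall x, `|x - a| < r -> forall ij : 'I_n * 'I_n,
    `|'D_(delta_mx 0 ij.1) (fun x => H x 0 ij.2) x| <= M.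
  apply: (@common_radius _ _ _ a (fun (ij : 'I_n * 'I_n) x =>
    `|'D_(delta_mx 0 ij.1) (fun x => H x 0 ij.2) x| <= M)) => -[i j].
  have := continuous_norm (Cinf_partial_continuous (v := delta_mx 0 i) (CH j) Ua) M0.
  by move=> [r r0 Hr]; exists r => // x /Hr /=; rewrite DH subr0.
have near2 : exists2 r, 0 < r & forall x, `|x - a| < r -> \det (partials F x) != 0.
  have Cd : Ck 1 U (fun x => \det (partials F x)).
    apply: Ck_det => // i j; apply: (@Ck_eq _ _ _ _
      ('D_(delta_mx 0 i) (fun y => F y 0 j))) => //; first by move=> x _; rewrite mxE.
    exact: Cinf_derive.
  have cd : {for a, continuous (fun x => \det (partials F x))}.
    by apply: differentiable_continuous; exact: Cd.1.
  have e0 : 0 < `|\det (partials F a)| / 2 by rewrite divr_gt0 // normr_gt0.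
  have [r r0 Hr] := continuous_norm cd e0; exists r => // x /Hr Hx.
  apply: contraTneq Hx => ->; rewrite sub0r normrN -ltNge.
  by rewrite ltr_pdivrMr // ltr_pMr ?ltr1n // normr_gt0.
have [r r0 Hr] := near_norm2 (open_norm oU Ua) (near_norm2 near1 near2).
have lipH x y : `|x - a| < r -> `|y - a| < r -> `|H y - H x| <= 2^-1 * `|y - x|.
  move=> xa ya; apply: norm_le_entries => [|i j]; first by rewrite mulr_ge0.
  rewrite (_ : (H y - H x) i j = H y 0 j - H x 0 j); last by rewrite ord1 !mxE.
  apply: le_trans (partials_lipschitz (F := fun x => H x 0 j) (M := M) _ xa ya) _.
    move=> z za k; have [Uz [/(_ (k, j)) zM _]] := Hr z za; split => //.
    by apply: diff_derivable; exact: Cinf_differentiable (CH j) Uz.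
  rewrite ler_wpM2r // /M invfM mulrCA ler_piMr // ler_pdivrMr // mul1r ler_nat.
  exact: leqnSn.
have [c c0 Lc] := norm_mulmx_le L.
pose rho := r / 2.
have rho0 : 0 < rho by rewrite divr_gt0.
have rhor : rho < r by rewrite ltr_pdivrMr // ltr_pMr // ltr1n.
(* With this radius [(y - F a) *m L] is shorter than [rho / 2], so the iteration maps the closed
   ball of radius [rho] into itself. *)
pose V := [set y : 'rV[R]_n | `|y - F a| < rho / (2 * c)].
have solve y : exists x, V y -> `|x - a| < rho /\ F x = y.
  (* The value outside [V] is arbitrary; it makes the existence unconditional, so that [choice]
     returns a total function. *)
  have [Vy|nVy] := pselect (V y); last by exists 0.
  have yL : `|(y - F a) *m L| < rho / 2.
    rewrite (le_lt_trans (Lc _)) // mulrC -ltr_pdivlMr //.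
    by move: Vy; rewrite /V /= invfM !mulrA.
  have T_a x : `|x - a| <= rho -> `|H x + y *m L - a| <= 2^-1 * `|x - a| + `|(y - F a) *m L|.
    move=> xa; have -> : H x + y *m L - a = (H x - H a) + (y - F a) *m L.
      rewrite /H mulmxBl; move: (F x *m L) (F a *m L) (y *m L) => u v w.
      by apply/rowP => k; rewrite !mxE; ring.
    apply: le_trans (ler_normD _ _) _; rewrite lerD2r lipH //.
      by rewrite subrr normr0.
    exact: le_lt_trans rhor.
  have [] := @contraction_fixed_point R n [set x | `|x - a| <= rho]
      (fun x => H x + y *m L).
  - move=> x /= xa; apply: (le_trans (T_a x xa)).
    by rewrite [leRHS]splitr lerD ?(ltW yL) // mulrC ler_wpM2r.
  - exact: closed_norm_ball.
  - by exists a; rewrite /= subrr normr0 ltW.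
  - move=> x z /= xa za; rewrite opprD addrACA subrr addr0.
    by apply: lipH; exact: le_lt_trans rhor.
  move=> x /= xa xE; exists x => _; split.
    have := T_a x xa; rewrite -xE => Hx.
    have : `|x - a| < 2^-1 * `|x - a| + rho / 2.
      by apply: (le_lt_trans Hx); rewrite ltrD2l.
    by lra.
  move/eqP: xE; rewrite /H -addrA addrC eq_sym -subr_eq0 addrK addrC subr_eq0 => /eqP E.
  have := congr1 (mulmxr (partials F a)) E => /=.
  by rewrite -!mulmxA mulVmx ?mulmx1 // unitmxE unitfE.
have [G HG] := choice solve.
have VG y : V y -> `|G y - a| < r.
  by move=> /HG [Gy _]; exact: lt_trans rhor.
(* Near [a] the map [F] shrinks distances by at most the factor [2 * c]. This gives injectivity as
   well as the Lipschitz bound for the inverse. *)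
have inj x z : `|x - a| < r -> `|z - a| < r -> `|z - x| <= 2 * c * `|F z - F x|.
  move=> xa za.
  have zx : z - x = (H z - H x) + (F z - F x) *m L.
    rewrite /H mulmxBl; move: (F x *m L) (F z *m L) => u v.
    by apply/rowP => k; rewrite !mxE; ring.
  have : `|z - x| <= 2^-1 * `|z - x| + c * `|F z - F x|.
    rewrite {1}zx; apply: le_trans (ler_normD _ _) _.
    by apply: lerD; [exact: lipH|exact: Lc].
  move: `|z - x| `|F z - F x| => N D ND; lra.
pose U1 := [set x : 'rV[R]_n | `|x - a| < r].
have oU1 : open U1.
  apply: norm_open => x /= xa; exists (r - `|x - a|); first by rewrite subr_gt0.
  move=> z zx; rewrite /U1 /= -(subrKA x) (le_lt_trans (ler_normD _ _)) //.
  by rewrite -ltrBrDr.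
have U1U : U1 `<=` U by move=> x /Hr [].
have oV : open V.
  apply: norm_open => x /= xa; exists (rho / (2 * c) - `|x - F a|).
    by rewrite subr_gt0.
  move=> z zx; rewrite /V /= -(subrKA x) (le_lt_trans (ler_normD _ _)) //.
  by rewrite -ltrBrDr.
have cF x : U x -> {for x, continuous F}.
  move=> Ux; apply: differentiable_continuous; apply: differentiable_rV => j.
  exact: Cinf_differentiable (CF j) Ux.
exists (U1 `&` F @^-1` V), V, G.
have VFa : V (F a) by rewrite /V /= subrr normr0 divr_gt0 // mulr_gt0.
split => //.
- split; last by split => //=; rewrite /U1 /= subrr normr0.
  apply: norm_open => x [U1x /= VFx].
  have [d d0 Hd] := open_norm oV VFx.
  have d20 : 0 < d / 2 by rewrite divr_gt0.
  have [s s0 Hs] := continuous_norm (cF _ (U1U _ U1x)) d20.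
  have [t t0 Ht] := near_norm2 (open_norm oU1 U1x) (ex_intro2 _ _ s s0 Hs).
  exists t => // z /Ht [U1z Fz]; split => //=; apply: Hd.
  by rewrite (le_lt_trans Fz) // ltr_pdivrMr // ltr_pMr // ltr1n.
- by move=> x [/U1U].
- apply: (@right_inverse_smooth _ _ F U1 V (2 * c)) => //.
  + by rewrite mulr_gt0.
  + by move=> j; exact: Cinf_sub (CF j).
  + by move=> x /Hr [_ [_]].
  + by move=> y /HG [].
  + move=> y z Vy Vz; have := inj _ _ (VG _ Vy) (VG _ Vz).
    by have [_ ->] := HG _ Vy; have [_ ->] := HG _ Vz.
- split=> [x [U1x VFx]|y Vy].
    split => //; have [_ FG] := HG _ VFx.
    have := inj _ _ U1x (VG _ VFx); rewrite FG subrr normr0 mulr0 normr_le0 subr_eq0.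
    by move/eqP.
  by have [Gy FG] := HG _ Vy; split => //; split; [exact: VG|rewrite /= FG].
Qed.

(** * Asymptotic expansions at 0 *)

Section asymptotics.
Context {R : realType}.
Implicit Types (f g : R -> R) (N : nat) (U : set R).

(** The point 0 is included, so for [N > 0] this also says that [f 0 = 0]. *)
Definition isbigO N f := exists C, exists2 d, 0 < d &
  forall s, `|s| < d -> `|f s| <= C * `|s| ^+ N.

Lemma isbigO_near N f g : (exists2 d, 0 < d & forall s, `|s| < d -> f s = g s) ->
  isbigO N f -> isbigO N g.
Proof.
move=> [d d0 fg] [C [e e0 fC]]; exists C, (Num.min d e); first by rewrite lt_min d0.
by move=> s; rewrite lt_min => /andP[sd se]; rewrite -fg ?fC.
Qed.

Lemma isbigO_ext N f g : f =1 g -> isbigO N f -> isbigO N g.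
Proof. by move=> fg; apply: isbigO_near; exists 1. Qed.

Lemma isbigOM N M f g : isbigO N f -> isbigO M g -> isbigO (N + M) (fun s => f s * g s).
Proof.
move=> [C [d d0 fC]] [D [e e0 gD]]; exists (C * D), (Num.min d e).
  by rewrite lt_min d0.
move=> s; rewrite lt_min => /andP[sd se].
by rewrite normrM exprD mulrACA ler_pM ?fC ?gD.
Qed.

Lemma isbigOX n : isbigO n (fun s => s ^+ n).
Proof. by exists 1, 1 => // s _; rewrite mul1r normrX. Qed.

Lemma isbigO_cst (c : R) : isbigO 0 (fun=> c).
Proof. by exists `|c|, 1 => // s _; rewrite expr0 mulr1. Qed.

Lemma isbigOZ N (c : R) f : isbigO N f -> isbigO N (fun s => c * f s).
Proof. by move=> fN; apply: (isbigOM (isbigO_cst c) fN). Qed.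

Lemma isbigOD N f g : isbigO N f -> isbigO N g -> isbigO N (fun s => f s + g s).
Proof.
move=> [C [d d0 fC]] [D [e e0 gD]]; exists (C + D), (Num.min d e).
  by rewrite lt_min d0.
move=> s; rewrite lt_min => /andP[sd se].
by rewrite (le_trans (ler_normD _ _))// mulrDl lerD ?fC ?gD.
Qed.

Lemma isbigOB N f g : isbigO N f -> isbigO N g -> isbigO N (fun s => f s - g s).
Proof.
move=> fN gN; apply: isbigO_ext (isbigOD fN (isbigOZ (-1) gN)) => s.
by rewrite mulN1r.
Qed.

Lemma isbigO_sum N (I : Type) (r : seq I) (P : pred I) (F : I -> R -> R) :
  (forall i, P i -> isbigO N (F i)) -> isbigO N (fun s => \sum_(i <- r | P i) F i s).
Proof.
move=> FN; elim: r => [|i r IH].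
  apply: isbigO_ext (_ : isbigO N (fun=> 0)); first by move=> s; rewrite big_nil.
  by exists 0, 1 => // s _; rewrite normr0 mul0r.
case Pi : (P i); last by apply: isbigO_ext IH => s; rewrite big_cons Pi.
by apply: isbigO_ext (isbigOD (FN i Pi) IH) => s; rewrite big_cons Pi.
Qed.

Lemma isbigO_gt0 N f : isbigO N f -> exists C d, [/\ 0 < C, 0 < d &
  forall s, `|s| < d -> `|f s| <= C * `|s| ^+ N].
Proof.
move=> [C [d d0 fC]]; exists (`|C| + 1), d; split => //.
move=> s /fC /le_trans -> //; rewrite ler_wpM2r ?exprn_ge0 //.
by rewrite (le_trans (ler_norm _)) // lerDl.
Qed.

Lemma isbigOW N M f : (M <= N)%N -> isbigO N f -> isbigO M f.
Proof.
move=> MN /isbigO_gt0 [C [d [C0 d0 fC]]].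
exists C, (Num.min d 1); first by rewrite lt_min d0 /=.
move=> s; rewrite lt_min => /andP[sd s1]; apply: le_trans (fC s sd) _.
by rewrite (ler_wpM2l (ltW C0)) // ler_wiXn2l // ltW.
Qed.

Lemma isbigO_comp N f m : isbigO N f -> isbigO 1 m -> isbigO N (fun s => f (m s)).
Proof.
move=> /isbigO_gt0 [C [d [C0 d0 fC]]] /isbigO_gt0 [D [e [D0 e0 mD]]].
exists (C * D ^+ N), (Num.min e (d / D)); first by rewrite lt_min e0 divr_gt0.
move=> s; rewrite lt_min => /andP[se]; rewrite ltr_pdivlMr // => sd.
have mDs : `|m s| <= D * `|s| by rewrite (le_trans (mD s se)) // expr1.
have md : `|m s| < d by apply: (le_lt_trans mDs); rewrite mulrC.
rewrite (le_trans (fC _ md)) // -mulrA -exprMn (ler_wpM2l (ltW C0)) //.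
by rewrite lerXn2r // nnegrE ?mulr_ge0 // ltW.
Qed.

Lemma continuous_isbigO0 f : {for 0, continuous f} -> isbigO 0 f.
Proof.
move=> /continuous_norm/(_ 1 ltr01) [d d0 fd]; exists (`|f 0| + 1), d => // s sd.
rewrite expr0 mulr1 -[X in `|X|](subrK (f 0)) (le_trans (ler_normD _ _)) //.
by rewrite addrC lerD2l; apply: fd; rewrite subr0.
Qed.

Lemma isbigO_primitive N f df :
  (exists2 d, 0 < d & forall s, `|s| < d -> is_derive s (1 : R) f (df s)) ->
  f 0 = 0 -> isbigO N df -> isbigO N.+1 f.
Proof.
move=> [d d0 fd] f0 /isbigO_gt0 [C [e [C0 e0 dfC]]]; exists C, (Num.min d e).
  by rewrite lt_min d0.
move=> s; rewrite lt_min => /andP[sd se].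
have H t : Num.min 0 s <= t <= Num.max 0 s -> `|t| <= `|s|.
  case: (leP 0 s) => s0 /andP[t1 t2].
    by rewrite !ger0_norm //; exact: le_trans t2.
  by rewrite !ler0_norm ?lerN2 // ltW.
have := @mean_value_bound R f df 0 s (C * `|s| ^+ N).
rewrite f0 !subr0 exprSr mulrA; apply=> t /H ts.
  by apply: fd; exact: le_lt_trans sd.
rewrite (le_trans (dfC t (le_lt_trans ts se))) // (ler_wpM2l (ltW C0)) //.
by rewrite lerXn2r.
Qed.

Lemma derive1_D1 f : (derive1 f) = 'D_(1 : R) f.
Proof. by apply/funext => x; rewrite derive1E. Qed.

Lemma Cinf_derive1 U f : Cinf U f -> Cinf U (derive1 f).
Proof. by rewrite derive1_D1; exact: Cinf_derive. Qed.

Lemma Cinf_is_derive U f x : Cinf U f -> U x -> is_derive x (1 : R) f ((derive1 f) x).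
Proof.
move=> Cf Ux; rewrite derive1_D1; apply/derivableP.
exact/diff_derivable/(Cinf_differentiable Cf Ux).
Qed.

Definition taylor f N := \poly_(i < N) ((derive1n i f) 0 / i`!%:R).

Lemma deriv_taylor f N : deriv (taylor f N.+1) = taylor (derive1 f) N.
Proof.
apply/polyP => i; rewrite coef_deriv !coef_poly ltnS; case: ifP => _; last by rewrite mul0rn.
rewrite -derive1Sn factS natrM invfM -[LHS]mulr_natr !mulrA mulrAC divfK //.
Qed.

(** The derivative of the remainder of [f] is the remainder of [f'] one order lower, so the mean
    value estimate of [isbigO_primitive] does the induction. *)
Lemma taylorP U f N : open U -> U 0 -> Cinf U f ->
  isbigO N (fun s => f s - (taylor f N).[s]).
Proof.
move=> oU U0; elim: N f => [|N IH] f Cf.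
  rewrite /taylor poly_def big_ord0; apply: isbigO_ext (_ : isbigO 0 f).
    by move=> s; rewrite horner0 subr0.
  by apply/continuous_isbigO0/differentiable_continuous/(Cinf_differentiable Cf).
apply: isbigO_primitive (IH _ (Cinf_derive1 Cf)); last first.
  rewrite horner_coef0 coef_poly /= fact0 divr1 subrr //.
have [d d0 dU] := open_norm oU U0; exists d => // s; rewrite -{1}(subr0 s) => /dU Us.
have := Cinf_is_derive Cf Us => Df; rewrite -deriv_taylor.
exact: is_deriveB.
Qed.

Lemma le0_small (a A e : R) : 0 < e -> (forall t, 0 < t < e -> a <= A * t) -> a <= 0.
Proof.
move=> e0 H; rewrite leNgt; apply/negP => a0.
pose t := Num.min e (a / (`|A| + 1)) / 2.
have A0 : 0 < `|A| + 1 by rewrite ltr_wpDl.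
have m0 : 0 < Num.min e (a / (`|A| + 1)) by rewrite lt_min e0 divr_gt0.
have t0 : 0 < t by rewrite divr_gt0.
have : t < Num.min e (a / (`|A| + 1)) by rewrite ltr_pdivrMr // ltr_pMr // ltr1n.
rewrite lt_min ltr_pdivlMr // => /andP[te ta].
have := H t; rewrite t0 te => /(_ isT); apply/negP; rewrite -ltNge.
by apply: le_lt_trans ta; rewrite mulrC (ler_wpM2l (ltW t0)) // (le_trans (ler_norm _)) // lerDl.
Qed.

(** Letting the variable tend to 0 kills the constant coefficient; then a factor of the variable is
    divided out on both sides. *)
Lemma poly_isbigO_eq0 N (p : {poly R}) : (size p <= N)%N ->
  isbigO N (horner p) -> p = 0.
Proof.
move=> + /isbigO_gt0 [C [e [C0 e0 H]]].
(* The point 0 is given up first, because the bound there would not survive the division. *)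
have {}H s : 0 < `|s| -> `|s| < e -> `|p.[s]| <= C * `|s| ^+ N by move=> _; exact: H.
elim: N p H => [|N IH] p H; first by rewrite leqn0 size_poly_eq0 => /eqP.
elim/poly_ind: p H => [//|q c _] H.
rewrite size_MXaddC => sq.
have sqN : (size q <= N)%N by move: sq; case: ifP => // /andP[/eqP ->]; rewrite size_poly0.
have /isbigO_gt0 [K [d [K0 d0 qK]]] := continuous_isbigO0 (@continuous_horner R q 0).
have c0 : c = 0.
  apply/eqP; rewrite -normr_le0; apply: (@le0_small _ (C + K) (Num.min 1 (Num.min e d))).
    by rewrite !lt_min ltr01 e0.
  move=> t; rewrite !lt_min => /and4P[t0 t1 te td].
  have nt : `|t| = t by rewrite gtr0_norm.
  have := H t; rewrite nt => /(_ t0 te); have := qK t; rewrite nt expr0 mulr1 => /(_ td).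
  rewrite hornerMXaddC => Kt Ct.
  rewrite -[X in `|X|](addKr (q.[t] * t)) addrC (le_trans (ler_normD _ _)) // normrN normrM nt.
  rewrite mulrDl lerD ?ler_pM2r // (le_trans Ct) // exprS mulrA.
  by rewrite ler_piMr ?mulr_ge0 ?exprn_ile1 // ltW.
subst c; rewrite addr0; rewrite (IH q) ?mul0r //.
move=> s s0 se; have := H s s0 se; rewrite addr0 hornerMX normrM exprSr mulrA.
by rewrite ler_pM2r.
Qed.

(** Used to read derivatives off an expansion obtained in another way, such as by composition. *)
Lemma taylor_unique U f N (p : {poly R}) : open U -> U 0 -> Cinf U f ->
  (size p <= N)%N -> isbigO N (fun s => f s - p.[s]) -> taylor f N = p.
Proof.
move=> oU U0 Cf pN fp; apply/eqP; rewrite -subr_eq0; apply/eqP.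
apply: (@poly_isbigO_eq0 N).
  rewrite (leq_trans (size_polyD _ _)) // size_polyN geq_max pN andbT.
  exact: size_poly.
apply: isbigO_ext (isbigOB fp (taylorP N oU U0 Cf)) => s.
by rewrite hornerD hornerN; ring.
Qed.

(** An estimate cannot be differentiated in general. Here it forces all Taylor polynomials of [f] to
    vanish, hence those of [f'], and [taylorP] for [f'] gives the estimate back. *)
Lemma flat_derive1 U f : open U -> U 0 -> Cinf U f -> (forall N, isbigO N f) ->
  forall N, isbigO N (derive1 f).
Proof.
move=> oU U0 Cf fO N.
have T0 M : taylor f M = 0.
  apply: taylor_unique oU U0 Cf _ _; first by rewrite size_poly0.
  by apply: isbigO_ext (fO M) => s; rewrite horner0 subr0.
apply: isbigO_ext (taylorP N oU U0 (Cinf_derive1 Cf)) => s.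
by rewrite -deriv_taylor T0 deriv0 horner0 subr0.
Qed.

End asymptotics.

(** * Flat functions *)

Section flat.
Context {R : realType}.
Implicit Types (f r : R -> R) (e : R).

(** Serves where no rule of calculus applies: at the point 0 of [sqrt_ext] and for the limit of the
    Borel series. *)
Lemma is_derive_quad f (x l : R) C d : 0 < d ->
  (forall h, `|h| < d -> `|f (h + x) - f x - h * l| <= C * h ^+ 2) ->
  is_derive x (1 : R) f l.
Proof.
move=> d0 H.
have cv : (h^-1 *: ((f \o shift x) (h *: 1) - f x)) @[h --> 0^'] --> l.
  apply/cvgrPdist_le => q q0.
  have A0 : 0 < `|C| + 1 by rewrite ltr_wpDl.
  near=> h.
  have h0 : h != 0 by near: h; exact: nbhs_dnbhs_neq.
  have hd : `|h| < Num.min d (q / (`|C| + 1)).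
    by near: h; apply: dnbhs0_lt; rewrite lt_min d0 divr_gt0.
  move: hd; rewrite lt_min ltr_pdivlMr // => /andP[hd hq].
  rewrite /= [h *: 1]mulr1 /GRing.scale /= distrC.
  have -> : h^-1 * (f (h + x) - f x) - l = h^-1 * (f (h + x) - f x - h * l).
    by rewrite [RHS]mulrBr mulKf.
  rewrite normrM normfV ler_pdivrMl ?normr_gt0 //.
  apply: le_trans (H h hd) _; rewrite -(real_normK (num_real h)) expr2.
  rewrite mulrCA ler_pM2l ?normr_gt0 //.
  apply: le_trans (ltW hq); rewrite mulrC ler_wpM2l // (le_trans (ler_norm _)) //.
  by rewrite lerDl.
by split; [apply/cvg_ex; exists l|exact: cvg_lim cv].
Unshelve. all: by end_near. Qed.

(** One-sided, because only values at square roots of positive numbers will be needed. *)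
Definition flat r := forall N, exists C, exists2 d, 0 < d &
  forall s, 0 < s < d -> `|r s| <= C * s ^+ N.

Fixpoint flat_upto k e r :=
  flat r /\ if k is k'.+1 then
    (forall s, 0 < s < e -> derivable r s 1) /\ flat_upto k' e ('D_(1 : R) r)
  else True.

Lemma flat_uptoS k e r : flat_upto k.+1 e r -> flat_upto k e r.
Proof.
elim: k r => [|k IH] r [fr [dr Dr]]; split => //.
by split => //; exact: IH.
Qed.

Lemma flat_eq e r1 r2 : 0 < e -> (forall s, 0 < s < e -> r1 s = r2 s) ->
  flat r1 -> flat r2.
Proof.
move=> e0 E f1 N; have [C [d d0 H]] := f1 N.
exists C, (Num.min d e); first by rewrite lt_min d0.
move=> s; rewrite lt_min => /and3P[s0 sd se].
by rewrite -E ?s0 ?H ?s0.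
Qed.

Lemma near_oo e s : 0 < s < e -> \forall t \near s, 0 < t < e.
Proof. by move=> H; apply: (@near_in_itvoo R 0 e s); rewrite in_itv. Qed.

Lemma flat_upto_eq k e r1 r2 : 0 < e -> (forall s, 0 < s < e -> r1 s = r2 s) ->
  flat_upto k e r1 -> flat_upto k e r2.
Proof.
move=> e0; elim: k r1 r2 => [|k IH] r1 r2 E [f1 H]; split=> //;
  try exact: (flat_eq e0 E f1).
case: H => d1 D1.
have nE s : 0 < s < e -> \near s, r1 s = r2 s.
  by move=> /near_oo; apply: filterS => t /E.
split=> [s se|]; first exact: near_eq_derivable (nE s se) (d1 s se).
by apply: IH D1 => s se; exact: near_eq_derive (nE s se).
Qed.

Lemma flatM (c : R) r : flat r -> flat (fun s => c * r s).
Proof.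
move=> f1 N; have [C [d d0 H]] := f1 N; exists (`|c| * C), d => // s /H Hs.
by rewrite normrM -mulrA ler_wpM2l.
Qed.

Lemma flatD r1 r2 : flat r1 -> flat r2 -> flat (fun s => r1 s + r2 s).
Proof.
move=> f1 f2 N; have [C [d d0 H]] := f1 N; have [D [e e0 K]] := f2 N.
exists (C + D), (Num.min d e); first by rewrite lt_min d0.
move=> s; rewrite lt_min => /and3P[s0 sd se].
by rewrite (le_trans (ler_normD _ _)) // mulrDl lerD ?H ?K ?s0.
Qed.

Lemma flatV r : flat r -> flat (fun s => r s / s).
Proof.
move=> f1 N; have [C [d d0 H]] := f1 N.+1; exists C, d => // s sd.
have /andP[s0 _] := sd.
by rewrite normrM normfV (gtr0_norm s0) ler_pdivrMr // -mulrA -exprSr H.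
Qed.

Lemma flat_uptoM k e (c : R) r : 0 < e -> flat_upto k e r ->
  flat_upto k e (fun s => c * r s).
Proof.
move=> e0; elim: k r => [|k IH] r [f1 H]; split=> //;
  try exact: flatM.
case: H => d1 D1; split=> [s se|]; first exact: derivableM (derivable_cst _ _ _) (d1 s se).
apply: flat_upto_eq (IH _ D1) => // s se.
by rewrite (@deriveMl _ _ _ c) //; exact: d1.
Qed.

Lemma flat_uptoD k e r1 r2 : 0 < e -> flat_upto k e r1 -> flat_upto k e r2 ->
  flat_upto k e (fun s => r1 s + r2 s).
Proof.
move=> e0; elim: k r1 r2 => [|k IH] r1 r2 [f1 H1] [f2 H2]; split=> //;
  try exact: flatD.
case: H1 H2 => d1 D1 [d2 D2]; split=> [s se|].
  exact: derivableD (d1 s se) (d2 s se).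
apply: flat_upto_eq (IH _ _ D1 D2) => // s se.
by rewrite deriveD //; [exact: d1|exact: d2].
Qed.

(** The derivative of [r / s] is [r' / s - (r / s) / s]. The induction hypothesis applies to [r'],
    and twice in succession for the second term: to [r], then to [r / s]. *)
Lemma flat_uptoV k e r : 0 < e -> flat_upto k e r -> flat_upto k e (fun s => r s / s).
Proof.
move=> e0; elim: k r => [|k IH] r H; first by split=> //; exact: flatV H.1.
have [f1 [d1 D1]] := H; have H' := IH _ (flat_uptoS H).
have dinv (s : R) : 0 < s -> is_derive s (1 : R) (fun s => s^-1) (- s ^- 2).
  move=> s0; have := @is_deriveV R id s 1 1; rewrite /= gt_eqF // => /(_ isT (is_derive_id _ _)).
  by rewrite [_ *: 1]mulr1.
split; first exact: flatV.
split=> [s /andP[s0 se]|].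
  by apply: derivableM; [exact/d1/andP|have [] := dinv s s0].
apply: flat_upto_eq (flat_uptoD e0 (IH _ D1) (flat_uptoM (-1) e0 (IH _ H'))) => // s /andP[s0 se].
have dr := derivableP (d1 s (introT andP (conj s0 se))).
have [_ ->] := is_deriveM dr (dinv s s0).
by rewrite /GRing.scale /=; field; exact: lt0r_neq0.
Qed.

(** Turns an even function of [s] into a function of [X = s ^ 2]. Flatness is what makes the
    extension by 0 smooth across [X = 0]. *)
Definition sqrt_ext r X := if 0 < X then r (Num.sqrt X) else 0.

(* The derivative is again a [sqrt_ext] of a flat function, so smoothness of
   [sqrt_ext] follows by induction on the order. *)
Lemma is_derive_sqrt_ext r e X : flat r -> (forall s, 0 < s < e -> derivable r s 1) ->
  0 < e -> X < e ^+ 2 ->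
  is_derive X (1 : R) (sqrt_ext r) (sqrt_ext (fun s => 2^-1 * ('D_(1 : R) r s / s)) X).
Proof.
move=> fr dr e0 Xe; rewrite {2}/sqrt_ext; case: (ltrgtP 0 X) => [X0|X0|X0].
- apply: (@near_eq_is_derive _ _ _ (r \o Num.sqrt)).
    near=> Y; rewrite /sqrt_ext ifT //; near: Y; exact: lt_nbhsr.
  have s0 : 0 < Num.sqrt X by rewrite sqrtr_gt0.
  have se : Num.sqrt X < e.
    by rewrite -(ger0_norm (ltW e0)) -sqrtr_sqr ltr_sqrt // exprn_gt0.
  have Dr := derivableP (dr _ (introT andP (conj s0 se))).
  apply: is_derive_eq (@is_derive1_comp R _ _ _ _ _ Dr (is_derive1_sqrt X0)) _.
  by rewrite invfM mulrCA.
- apply: (@near_eq_is_derive _ _ _ (cst 0)).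
    near=> Y; rewrite /sqrt_ext ifF //; apply/negbTE; rewrite -leNgt; apply: ltW.
    by near: Y; exact: lt_nbhsl.
(* Order 4 in [s] is order 2 in [X], as [is_derive_quad] demands. *)
- rewrite -X0; have [C [d d0 H]] := fr 4%N.
  apply: (@is_derive_quad _ _ _ `|C| (d ^+ 2)); first by rewrite exprn_gt0.
  move=> h hd; rewrite /sqrt_ext ltxx addr0 subr0 mulr0 subr0.
  case: ifP => [h0|_]; last by rewrite normr0 mulr_ge0 // sqr_ge0.
  have hd' : Num.sqrt h < d.
    rewrite -(ger0_norm (ltW d0)) -sqrtr_sqr ltr_sqrt ?exprn_gt0 //.
    by apply: le_lt_trans hd; exact: ler_norm.
  apply: (le_trans (H (Num.sqrt h) _)); first by rewrite sqrtr_gt0 h0.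
  rewrite (exprM _ 2 2) sqr_sqrtr ?(ltW h0) //.
  by rewrite ler_wpM2r ?sqr_ge0 // ler_norm.
Unshelve. all: by end_near. Qed.

Lemma derive_scale f (x v : R) : derivable f x 1 -> 'D_v f x = v * 'D_1 f x.
Proof.
move=> /derivable1_diffP df; rewrite !deriveE // -[in LHS](mulr1 v).
by rewrite [LHS]linearZ.
Qed.

Lemma Ck_sqrt_ext k e r : 0 < e -> flat_upto k e r ->
  Ck k [set X | X < e ^+ 2] (sqrt_ext r).
Proof.
move=> e0; elim: k r => [//|k IH] r [fr [dr Dr]].
have DE X : X < e ^+ 2 -> is_derive X (1 : R) (sqrt_ext r) _ :=
  is_derive_sqrt_ext fr dr e0.
split=> [X /DE [dX _]|v]; first exact/derivable1_diffP.
have := IH _ (flat_uptoM 2^-1 e0 (flat_uptoV e0 Dr)).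
move=> /(CkZ v (@open_lt _ _)); apply: Ck_eq; first exact: open_lt.
by move=> X /DE [dX DX]; rewrite derive_scale // DX.
Qed.

Lemma flat_upto_Cinf k e U r : open U -> U 0 -> (forall s, 0 < s < e -> U s) ->
  Cinf U r -> (forall N, isbigO N r) -> flat_upto k e r.
Proof.
move=> oU U0 Ue; elim: k r => [|k IH] r Cr Or.
  split=> // N; have [C [d d0 H]] := Or N; exists C, d => // s /andP[s0 sd].
  by rewrite -{2}(gtr0_norm s0) H // gtr0_norm.
split.
  move=> N; have [C [d d0 H]] := Or N; exists C, d => // s /andP[s0 sd].
  by rewrite -{2}(gtr0_norm s0) H // gtr0_norm.
split=> [s /Ue Us|]; first by apply: diff_derivable; exact: Cinf_differentiable Cr Us.
by rewrite -derive1_D1; apply: IH; [exact: Cinf_derive1|exact: flat_derive1 oU U0 Cr Or].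
Qed.

End flat.

(** * Borel's theorem *)

Section borel.
Context {R : realType}.
Implicit Types (b : nat -> R -> R) (n k N : nat) (c x : R).

(** A function carried together with all its derivatives, so that limits can be taken for every
    order at once. *)
Definition derivs_on (U : set R) b :=
  forall k x, U x -> is_derive x (1 : R) (b k) (b k.+1 x).

Lemma derivs_on_Ck U b n k : open U -> derivs_on U b -> Ck n U (b k).
Proof.
move=> oU ch; elim: n k => [//|n IH] k; split=> [x Ux|v].
  by apply/derivable1_diffP; have [] := ch k x Ux.
apply: Ck_eq (CkZ v oU (IH k.+1)) => // x Ux.
by have [dx Dx] := ch k x Ux; rewrite derive_scale // Dx.
Qed.

Lemma derivs_on_derive1n U b n x : open U -> derivs_on U b -> U x ->
  derive1n n (b 0%N) x = b n x.
Proof.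
move=> oU ch; elim: n x => [//|n IH] x Ux.
rewrite derive1nS derive1E (@near_eq_derive _ _ _ _ (b n)).
  by have [] := ch n x Ux.
by apply: filterS (open_nbhs_nbhs (conj oU Ux)) => y /IH.
Qed.

(* The [n]-th derivative is [c * cos (l x)] with [l] large, so the primitives of lower
   order vanishing at 0 are small on [-1, 1]. *)
Lemma borel_step n c : exists b, [/\ derivs_on setT b,
  (forall k, (k < n)%N -> forall x, `|x| <= 1 -> `|b k x| <= 2^-1 ^+ n),
  (forall k, (k < n)%N -> b k 0 = 0) & b n 0 = c].
Proof.
(* Chosen so that [2 * |c| / l] is at most [2^-n]. *)
pose l : R := 1 + 2 * `|c| * 2 ^+ n.
have l0 : 0 < l by rewrite ltr_pwDl // !mulr_ge0 // exprn_ge0.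
(* Each derivative of the cosine advances the phase by a quarter turn; the phase is 0 at order [n],
   where the value at 0 must be [c]. *)
pose th k : R := (k%:R - n%:R) * (pi / 2).
pose u k x := c * (l ^+ k / l ^+ n) * cos (l * x + th k).
(* Subtracting this Taylor polynomial of [u 0] makes the derivatives below order [n] vanish at 0 and
   leaves the [n]-th one unchanged. *)
pose p := \poly_(i < n) (u i 0 / i`!%:R).
pose b k x := u k x - (derivn k p).[x].
have du k x : is_derive x (1 : R) (u k) (u k.+1 x).
  have Dl : is_derive x (1 : R) (fun x => l * x + th k) l.
    have : is_derive x (1 : R) ((fun x => l * x) + cst (th k)) (l + 0).
      apply: is_deriveD; apply: is_derive_eq (is_deriveM _ _) _ => /=.
      by rewrite /GRing.scale /= mulr0 addr0 mulr1.
    by rewrite addr0.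
  have Dc := is_derive1_comp (is_derive_cos _) Dl.
  apply: is_derive_eq (is_deriveZ (c * (l ^+ k / l ^+ n)) Dc) _.
  have thS : th k.+1 = th k + pi / 2 by rewrite /th -natr1; ring.
  by rewrite /u thS addrA cosDpihalf exprS /GRing.scale /=; ring.
have db : derivs_on setT b.
  move=> k x _; exact: is_deriveB.
have b0 k : (k < n)%N -> b k 0 = 0.
  move=> kn; rewrite /b horner_coef0 coef_derivn addn0 coef_poly kn ffactnn.
  by rewrite -[X in _ - X]mulr_natr divfK ?subrr // pnatr_eq0 -lt0n fact_gt0.
have pn0 : derivn n p = 0 by apply: derivn_poly0; exact: size_poly.
exists b; split => //; last first.
  rewrite /b pn0 horner0 subr0 /u /th subrr mul0r mulr0 addr0 cos0 mulr1.
  by rewrite divff ?mulr1 // expf_neq0 // gt_eqF.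
have lM : 2 * `|c| / l <= 2^-1 ^+ n.
  rewrite ler_pdivrMr // exprVn [leRHS]mulrC ler_pdivlMr ?exprn_gt0 //.
  by rewrite /l lerDr.
(* Downward induction from order [n - 1], where the bound is that of a difference of two cosines;
   below, the mean value estimate on [-1, 1] preserves it. *)
suff H j k x : (k + j.+1 = n)%N -> `|x| <= 1 -> `|b k x| <= 2 * `|c| / l.
  move=> k kn x x1; apply: le_trans lM; apply: (H (n - k.+1)%N) => //.
  by rewrite -addSnnS subnKC.
elim: j k x => [|j IH] k x kn x1.
  have E : (derivn k p).[x] = (derivn k p).[0].
    apply: is_derive_0_is_cst => y.
    apply: is_derive_eq (is_derive_poly _ _) _.
    by rewrite -derivnS -addn1 kn pn0 horner0.
  have ub y : `|u k y| <= `|c| / l.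
    rewrite /u normrM -[leRHS]mulr1.
    apply: ler_pM => //; last by rewrite ler_norml cos_geN1 cos_le1.
    rewrite normrM ler_wpM2l // -kn addn1 exprS invfM mulrCA divff ?mulr1.
      by rewrite gtr0_norm // invr_gt0.
    by rewrite expf_neq0 // gt_eqF.
  have bk0 : b k 0 = 0 by apply: b0; rewrite -kn addn1.
  have -> : b k x = u k x - u k 0.
    by move: bk0; rewrite /b E => /eqP; rewrite subr_eq0 => /eqP <-.
  by rewrite (le_trans (ler_normB _ _)) // -mulrA mulr_natl mulr2n lerD.
have bk0 : b k 0 = 0 by apply: b0; rewrite -kn addnS leq_addr.
have M0 : 0 <= 2 * `|c| / l by rewrite divr_ge0 ?mulr_ge0 // ltW.
have := @mean_value_bound R (b k) (b k.+1) 0 x (2 * `|c| / l).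
rewrite bk0 !subr0 => MV; apply: (le_trans (MV _ _)).
- move=> t tx; apply: IH; first by rewrite addSnnS.
  apply: le_trans x1; move: tx.
  case: (leP 0 x) => s0 /andP[t1 t2]; first by rewrite !ger0_norm // (le_trans t1).
  by rewrite !ler0_norm ?lerN2 // ltW.
- by rewrite -[leRHS]mulr1 ler_wpM2l.
Qed.

Lemma derivs_onD U b1 b2 : derivs_on U b1 -> derivs_on U b2 ->
  derivs_on U (fun k x => b1 k x + b2 k x).
Proof. by move=> c1 c2 k x Ux; apply: is_deriveD; [exact: c1|exact: c2]. Qed.

Lemma derivs_on_bounded b k : derivs_on setT b ->
  exists K, forall x, `|x| <= 1 -> `|b k x| <= K.
Proof.
move=> ch; have cb : {within `[-1, 1], continuous (fun x => `|b k x|)}.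
  apply: continuous_subspaceT => x; apply: continuous_comp; last exact: norm_continuous.
  apply: differentiable_continuous; apply/derivable1_diffP.
  by have [] := ch k x I.
have le11 : (-1 : R) <= 1 by rewrite (le_trans (lerN10 _)).
have [z _ zM] := EVT_max le11 cb; exists `|b k z| => x x1; apply: zM.
by rewrite in_itv /= -ler_norml.
Qed.

Variables (a : nat -> R) (step : nat -> R -> nat -> R -> R).
Hypothesis stepP : forall n c, [/\ derivs_on setT (step n c),
  (forall k, (k < n)%N -> forall x, `|x| <= 1 -> `|step n c k x| <= 2^-1 ^+ n),
  (forall k, (k < n)%N -> step n c k 0 = 0) & step n c n 0 = c].

(** Step [N] supplies what the earlier terms leave missing in the [N]-th derivative at 0; it does
    not disturb the lower ones. *)
Fixpoint borel_partial N : nat -> R -> R :=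
  if N is N'.+1 then
    fun k x => borel_partial N' k x + step N' (a N' - borel_partial N' N' 0) k x
  else fun _ _ => 0.
Local Notation P := borel_partial.

Let P_derivs N : derivs_on setT (P N).
Proof.
elim: N => [|N IH] /=; first by move=> k x _; exact: is_derive_cst.
by apply: derivs_onD => //; have [] := stepP N (a N - P N N 0).
Qed.

Let P0 k N : (k < N)%N -> P N k 0 = a k.
Proof.
elim: N => [//|N IH]; rewrite ltnS leq_eqVlt => /predU1P[->|kN] /=.
  by have [_ _ _ ->] := stepP N (a N - P N N 0); rewrite addrC subrK.
by have [_ _ /(_ k kN) -> _] := stepP N (a N - P N N 0); rewrite addr0 IH.
Qed.

Let P_dist k N m x : (k < N)%N -> `|x| <= 1 ->
  `|P (N + m) k x - P N k x| <= 2 * 2^-1 ^+ N.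
Proof.
move=> kN x1.
(* The geometric tail is kept in closed form so that the induction on [m] goes through. *)
suff : `|P (N + m) k x - P N k x| <= 2 * 2^-1 ^+ N - 2 * 2^-1 ^+ (N + m).
  by move=> /le_trans -> //; rewrite gerBl mulr_ge0 // exprn_ge0.
elim: m => [|m IH]; first by rewrite addn0 !subrr normr0.
rewrite addnS /= addrAC (le_trans (ler_normD _ _)) //.
have [_ /(_ k _ x x1) H _ _] := stepP (N + m)%N (a (N + m)%N - P (N + m)%N (N + m)%N 0).
apply: (le_trans (lerD IH (H (ltn_addr _ kN)))).
by rewrite exprS mulrA divff // mul1r; lra.
Qed.

Let P_bounded k : exists K, forall N x, `|x| <= 1 -> `|P N k x| <= K.
Proof.
have [K HK] : exists K, forall N x, (N <= k.+1)%N -> `|x| <= 1 -> `|P N k x| <= K.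
  elim: k.+1 => [|m [K HK]].
    have [K HK] := derivs_on_bounded k (P_derivs 0).
    by exists K => N x; rewrite leqn0 => /eqP ->; exact: HK.
  have [K' HK'] := derivs_on_bounded k (P_derivs m.+1).
  exists (Num.max K K') => N x; rewrite leq_eqVlt ltnS => /predU1P[->|Nm] x1.
    by rewrite le_max HK' ?orbT.
  by rewrite le_max HK.
(* Finitely many partial sums are bounded by compactness; the later ones stay close to number
   [k.+1]. *)
exists (K + 2 * 2^-1 ^+ k.+1) => N x x1.
have [Nk|kN] := leqP N k.+1.
  by rewrite (le_trans (HK _ _ Nk x1)) // lerDl mulr_ge0 // exprn_ge0.
rewrite -(subnKC (ltnW kN)) -[X in `|X|](subrK (P k.+1 k x)).
rewrite (le_trans (ler_normD _ _)) // addrC lerD //; first exact: HK.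
exact: P_dist.
Qed.

Let P_cvg k x : `|x| <= 1 -> cvgn (fun N => P N k x).
Proof.
move=> x1; apply/cauchy_cvgP/cauchy_exP => e e0.
have [M _ HM] : \forall N \near \oo, 2 * 2^-1 ^+ N < e.
  have : (fun N => 2 * 2^-1 ^+ N : R) @ \oo --> (2 * 0 : R).
    by apply: cvgMr; apply: cvg_expr; rewrite gtr0_norm // invf_lt1 // ltr1n.
  rewrite mulr0 => /cvgr0_norm_lt/(_ _ e0); apply: filterS => N.
  by rewrite ger0_norm // mulr_ge0 // exprn_ge0.
pose N := maxn k.+1 M.
exists (P N k x); exists N => // m /= Nm.
rewrite /ball /= distrC -(subnKC Nm).
apply: le_lt_trans (P_dist _ _ x1) (HM _ _); first exact: leq_maxl.
exact: leq_maxr.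
Qed.

(** Differentiation under the limit: the partial sums have second-order error at most [K * h ^ 2],
    where [K] bounds the derivatives two orders up uniformly in [N]. Such an inequality passes to a
    pointwise limit, and [is_derive_quad] concludes. *)
Lemma borel_series : exists G, Cinf [set x : R | `|x| < 1] G /\
  forall n, derive1n n G 0 = a n.
Proof.
pose U := [set x : R | `|x| < 1].
have oU : open U.
  rewrite (_ : U = (fun x => `|x|) @^-1` [set t | t < 1]) //.
  by apply: open_comp; [move=> x _; exact: norm_continuous|exact: open_lt].
pose G k x := limn (fun N => P N k x).
have ch : derivs_on U G.
  move=> k x Ux; have [K HK] := P_bounded k.+2.
  have d0 : 0 < 1 - `|x| by rewrite subr_gt0.
  apply: (is_derive_quad d0 (C := K)) => h hd.
  have xh : `|h + x| <= 1.
    by rewrite (le_trans (ler_normD _ _)) // -lerBrDr ltW.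
  have x1 : `|x| <= 1 by exact: ltW.
  have cv : (fun N => `|P N k (h + x) - P N k x - h * P N k.+1 x|) @ \oo -->
      `|G k (h + x) - G k x - h * G k.+1 x|.
    apply: cvg_norm; apply: cvgB; first by apply: cvgB; exact: P_cvg.
    by apply: cvgMr; exact: P_cvg.
  rewrite -(cvg_lim _ cv) //; apply: limr_le; first by apply/cvg_ex; eexists; exact: cv.
  apply: nearW => N.
  have seg t : Num.min x (h + x) <= t <= Num.max x (h + x) -> `|t - x| <= `|h| /\ `|t| <= 1.
    move: x1 xh; rewrite !ler_norml.
    case: (leP x (h + x)) => s0 /andP[? ?] /andP[? ?] /andP[? ?].
      have h0 : 0 <= h by lra.
      by rewrite (ger0_norm h0); split; apply/andP; split; lra.
    have h0 : h <= 0 by lra.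
    by rewrite (ler0_norm h0); split; apply/andP; split; lra.
  have B1 t : Num.min x (h + x) <= t <= Num.max x (h + x) ->
      `|P N k.+1 t - P N k.+1 x| <= K * `|h|.
    move=> /seg [th t1].
    have := @mean_value_bound R (P N k.+1) (P N k.+2) x t K.
    move=> H; have K0 : 0 <= K by apply: le_trans (HK 0%N 0 _); rewrite ?normr0.
    apply: le_trans (ler_wpM2l K0 th); apply: H => s; first by move=> _; exact: P_derivs.
    move=> sxt; apply: HK; move: sxt x1 t1; rewrite !ler_norml.
    by case: (leP x t) => ? /andP[? ?] /andP[? ?] /andP[? ?]; apply/andP; split; lra.
  have := @mean_value_bound R (fun t => P N k t - t * P N k.+1 x)
    (fun t => P N k.+1 t - P N k.+1 x) x (h + x) (K * `|h|) _ B1.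
  rewrite addrK -mulrA -expr2 real_normK ?num_real // => H.
  apply: le_trans (H _); last first.
    move=> t _; apply: is_deriveB; first exact: P_derivs.
    apply: is_derive_eq (is_deriveM _ _) _.
    by rewrite /GRing.scale /= mulr0 add0r mulr1.
  by rewrite le_eqVlt; apply/orP; left; apply/eqP; congr (`|_|); ring.
exists (G 0%N); split=> [n|n]; first exact: derivs_on_Ck.
rewrite (derivs_on_derive1n _ oU ch); last by rewrite /U /= normr0.
apply: lim_near_cst => //; exists n.+1 => // N /= nN; exact: P0.
Qed.

End borel.

Theorem borel (R : realType) (a : nat -> R) :
  exists G, Cinf [set x : R | `|x| < 1] G /\ forall n, derive1n n G 0 = a n.
Proof.
have [step stepP] := choice (fun nc : nat * R => borel_step nc.1 nc.2).
exact: (@borel_series R a (fun n c => step (n, c)) (fun n c => stepP (n, c))).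
Qed.

(** * Whitney's even-odd decomposition *)

Section whitney.
Context {R : realType}.
Implicit Types (f h : R -> R) (e s X : R).

Lemma open_absball e : open [set s : R | `|s| < e].
Proof.
rewrite (_ : [set _ | _] = (fun s : R => `|s|) @^-1` [set t | t < e]) //.
by apply: open_comp; [move=> x _; exact: norm_continuous|exact: open_lt].
Qed.

Lemma Cinf_id (U : set R) : Cinf U id.
Proof.
case=> [//|k]; split=> [x _|v]; first exact/derivable1_diffP/derivable_id.
rewrite (_ : 'D_v id = fun=> v); first exact: Ck_cst.
by apply/funext => x; rewrite derive_id.
Qed.

Lemma sum_even_odd (a : nat -> R) m M s : (forall i, (i < m)%N -> a i.*2.+1 = 0) ->
  \sum_(k < (m + M).*2) a k * s ^+ k =
  \sum_(i < m + M) a i.*2 * (s ^+ 2) ^+ i +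
  s ^+ m.*2.+1 * \sum_(i < M) a (m + i).*2.+1 * (s ^+ 2) ^+ i.
Proof.
move=> a0.
have step K : \sum_(k < K.+1.*2) a k * s ^+ k = \sum_(k < K.*2) a k * s ^+ k +
    a K.*2 * (s ^+ 2) ^+ K + a K.*2.+1 * s ^+ K.*2.+1.
  by rewrite doubleS !big_ord_recr /= -exprM mul2n.
elim: M => [|M IH].
  rewrite addn0 big_ord0 mulr0 addr0; elim: m a0 => [|m IH] a0.
    by rewrite !big_ord0.
  rewrite step IH; last by move=> i im; apply: a0; exact: ltnW.
  by rewrite big_ord_recr /= a0 // mul0r addr0.
have E : s ^+ (m + M).*2.+1 = s ^+ m.*2.+1 * (s ^+ 2) ^+ M.
  by rewrite -exprM -exprD mul2n addSn -doubleD.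
by rewrite addnS step IH !big_ord_recr /= E; ring.
Qed.

Lemma isbigO_opp N f : isbigO N f -> isbigO N (fun s => f (- s)).
Proof.
move=> fN; apply: (isbigO_comp fN); exists 1, 1 => // s _.
by rewrite mul1r normrN expr1.
Qed.

Lemma flat_uptoVX k e (r : R -> R) j : 0 < e -> flat_upto k e r ->
  flat_upto k e (fun s => r s / s ^+ j).
Proof.
move=> e0 fr; elim: j => [|j IH].
  by apply: flat_upto_eq fr => // s _; rewrite expr0 divr1.
apply: flat_upto_eq (flat_uptoV e0 IH) => // s _.
by rewrite exprS invfM mulrA mulrAC.
Qed.

(** The even part and the odd part divided by [s ^ (2m+1)] are both flat and even, so [sqrt_ext]
    applies to each. [E' 0 = 0] and [D 0 = 0] ensure that the flat remainder does not alter the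
    coefficients prescribed through Borel's theorem. *)
Lemma flat_even_odd e (r : R -> R) m : 0 < e -> Cinf [set s | `|s| < e] r ->
  (forall N, isbigO N r) ->
  exists E D, [/\ Cinf [set X | X < e ^+ 2] E, Cinf [set X | X < e ^+ 2] D,
    derive1 E 0 = 0 /\ D 0 = 0 &
    forall s, `|s| < e -> r s = E (s ^+ 2) + s ^+ m.*2.+1 * D (s ^+ 2)].
Proof.
move=> e0 Cr Or; pose U := [set s : R | `|s| < e].
have oU : open U by exact: open_absball.
have U0 : U 0 by rewrite /U /= normr0.
have Ue s : 0 < s < e -> U s by move=> /andP[s0 se]; rewrite /U /= gtr0_norm.
have CN : Cinf U (fun s => r (- s)).
  move=> k; apply: (@Ck_comp1 _ _ _ _ U (fun s => - s)) => //.
    apply: Ck_eq (CkZ (-1) oU (@Cinf_id U k)) => // s _; exact: mulN1r.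
  by move=> s; rewrite /U /= normrN.
pose re s := 2^-1 * (r s + r (- s)); pose ro s := 2^-1 * (r s - r (- s)).
have fe k : flat_upto k e re.
  apply: (@flat_upto_Cinf _ k e U re oU U0 Ue) => [j|N].
    exact: (CkZ 2^-1 oU (CkD oU (Cr j) (CN j))).
  by apply: isbigOZ; apply: isbigOD => //; exact: isbigO_opp.
have fo k : flat_upto k e ro.
  apply: (@flat_upto_Cinf _ k e U ro oU U0 Ue) => [j|N].
    exact: (CkZ 2^-1 oU (CkB oU (Cr j) (CN j))).
  by apply: isbigOZ; apply: isbigOB => //; exact: isbigO_opp.
exists (sqrt_ext re), (sqrt_ext (fun s => ro s / s ^+ m.*2.+1)); split.
- by move=> k; exact: Ck_sqrt_ext.
- by move=> k; apply: Ck_sqrt_ext => //; exact: flat_uptoVX.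
- split; last by rewrite /sqrt_ext ltxx.
  have [fr [dr _]] := fe 1%N.
  have [_] := @is_derive_sqrt_ext _ re e 0 fr dr e0 (exprn_gt0 _ e0).
  by rewrite derive1E => ->; rewrite /sqrt_ext ltxx.
have ereE s : re (- s) = re s by rewrite /re opprK addrC.
have eroE s : ro (- s) = - ro s by rewrite /ro opprK -mulrN opprB.
have main s : 0 < s -> re s + s ^+ m.*2.+1 * (ro s / s ^+ m.*2.+1) = r s.
  move=> s0; rewrite mulrC divfK ?expf_neq0 ?gt_eqF // /re /ro; lra.
move=> s se; rewrite /sqrt_ext; case: (ltrgtP s 0) => [s0|s0|->].
- have s20 : 0 < s ^+ 2 by rewrite exprn_even_gt0 //= lt_eqF.
  rewrite s20 sqrtr_sqr ltr0_norm // ereE eroE exprNn -signr_odd /= odd_double /=.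
  rewrite expr1 mulN1r invrN mulrNN mulrC divfK ?expf_neq0 ?lt_eqF // /re /ro; lra.
- have s20 : 0 < s ^+ 2 by rewrite exprn_even_gt0 //= gt_eqF.
  by rewrite s20 sqrtr_sqr gtr0_norm // main.
- rewrite expr0n ltxx mulr0 addr0; have [C [d d0 /(_ 0)]] := Or 1%N.
  by rewrite normr0 expr1 mulr0 => /(_ d0); rewrite normr_le0 => /eqP.
Qed.

Theorem whitney_even_odd e h m : 0 < e -> Cinf [set s | `|s| < e] h ->
  (forall i, (i < m)%N -> derive1n i.*2.+1 h 0 = 0) ->
  exists E D d, [/\ 0 < d, Cinf [set X | `|X| < d] E /\ Cinf [set X | `|X| < d] D,
    derive1 E 0 = derive1n 2 h 0 / 2, D 0 = derive1n m.*2.+1 h 0 / (m.*2.+1)`!%:R &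
    forall s, s ^+ 2 < d -> h s = E (s ^+ 2) + s ^+ m.*2.+1 * D (s ^+ 2)].
Proof.
move=> e0 Ch h0; pose a k := derive1n k h 0 / k`!%:R.
have a0 i : (i < m)%N -> a i.*2.+1 = 0 by move=> /h0; rewrite /a => ->; rewrite mul0r.
(* The factorials convert the wanted Taylor coefficients into derivatives. *)
have [E0 [CE0 E0a]] := borel (fun i => a i.*2 * i`!%:R).
have [D0 [CD0 D0a]] := borel (fun i => a (m + i).*2.+1 * i`!%:R).
(* The Borel functions live on the unit interval, so [s ^ 2] must stay below 1. *)
pose e1 := Num.min e 1.
have e10 : 0 < e1 by rewrite lt_min e0 ltr01.
pose U := [set s : R | `|s| < e1]; have oU : open U by exact: open_absball.
have U0 : U 0 by rewrite /U /= normr0.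
pose B := [set s : R | `|s| < 1]; have oB : open B by exact: open_absball.
have B0 : B 0 by rewrite /B /= normr0.
have UB s : U s -> B (s ^+ 2).
  rewrite /U /B /= lt_min => /andP[_ s1]; rewrite normrX expr2.
  by rewrite mulr_ilt1.
have CU : Cinf U h by apply: Cinf_sub Ch => s; rewrite /U /= lt_min => /andP[].
have Csq G : Cinf B G -> Cinf U (fun s => G (s ^+ 2)).
  move=> CG k; apply: (@Ck_comp1 _ _ _ _ B (fun s => s ^+ 2)) => //.
  by apply: CkX => //; exact: Cinf_id.
pose r s := h s - E0 (s ^+ 2) - s ^+ m.*2.+1 * D0 (s ^+ 2).
have Cr : Cinf U r.
  move=> k; apply: CkB => //; first by apply: CkB => //; exact: Csq.
  by apply: CkM => //; [apply: CkX => //; exact: Cinf_id|exact: Csq].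
have sq1 : isbigO 1 (fun s : R => s ^+ 2) by apply: isbigOW (isbigOX 2).
have Or N : isbigO N r.
  have Oh := isbigOW (_ : (N <= (m + N).*2)%N) (taylorP (m + N).*2 oU U0 CU).
  have OE := isbigOW (_ : (N <= m + N)%N) (isbigO_comp (taylorP (m + N) oB B0 CE0) sq1).
  have OD := isbigOM (isbigOX m.*2.+1) (isbigO_comp (taylorP N oB B0 CD0) sq1).
  have {}OD := isbigOW (leq_addl _ _) OD.
  have mN : (N <= m + N)%N by exact: leq_addl.
  have {}Oh := Oh (leq_trans mN (leq_trans (leq_addr _ _) (eq_leq (addnn _)))).
  apply: isbigO_ext (isbigOB (isbigOB Oh (OE mN)) OD) => s.
  have TE n f x : (taylor f n).[x] = \sum_(i < n) derive1n i f 0 / i`!%:R * x ^+ i.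
    by rewrite horner_poly.
  have f0 i : i`!%:R != 0 :> R by rewrite pnatr_eq0 -lt0n fact_gt0.
  have TE0 n x : (taylor E0 n).[x] = \sum_(i < n) a i.*2 * x ^+ i.
    by rewrite TE; apply: eq_bigr => i _; rewrite E0a mulfK.
  have TD0 n x : (taylor D0 n).[x] = \sum_(i < n) a (m + i).*2.+1 * x ^+ i.
    by rewrite TE; apply: eq_bigr => i _; rewrite D0a mulfK.
  rewrite TE0 TD0 TE (sum_even_odd _ _ a0) /r; ring.
have [E [D [CE CD [E'0 D00] rE]]] := flat_even_odd m e10 Cr Or.
pose d := e1 ^+ 2; have d0 : 0 < d by rewrite exprn_gt0.
pose W := [set X : R | `|X| < d]; have oW : open W by exact: open_absball.
have WB : W `<=` B.
  move=> X; rewrite /W /B /= => /lt_le_trans -> //.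
  have e11 : e1 <= 1 by rewrite /e1 ge_min lexx orbT.
  by rewrite exprn_ile1 // ltW.
have WL : W `<=` [set X | X < d] by move=> X /=; apply: le_lt_trans; exact: ler_norm.
have W0 : W 0 by rewrite /W /= normr0.
exists (fun X => E0 X + E X), (fun X => D0 X + D X), d; split => //.
- split=> k.
    by apply: CkD => //; [exact: Cinf_sub CE0 k|exact: Cinf_sub CE k].
  by apply: CkD => //; [exact: Cinf_sub CD0 k|exact: Cinf_sub CD k].
- have [dE0 DE0] := Cinf_is_derive CE0 B0.
  have [dE DE] := Cinf_is_derive CE (exprn_gt0 2 e10 : [set X | X < d] 0).
  rewrite derive1E deriveD // DE0 DE E'0 addr0.
  by have := E0a 1%N; rewrite derive1n1 => ->; rewrite [LHS]mulr1.
- by rewrite D00 addr0; have := D0a 0%N; rewrite derive1n0 addn0 => ->; rewrite [LHS]mulr1.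
move=> s sd.
have se : `|s| < e1.
  rewrite -(gtr0_norm e10) -ltr_sqr ?nnegrE //.
  by rewrite -!normrX !ger0_norm ?sqr_ge0.
have := rE s se; rewrite /r => /eqP; rewrite subr_eq => /eqP H.
have {}H : h s = E (s ^+ 2) + s ^+ m.*2.+1 * D (s ^+ 2) + s ^+ m.*2.+1 * D0 (s ^+ 2) + E0 (s ^+ 2).
  by rewrite -H subrK.
by rewrite H; ring.
Qed.

End whitney.

(** * Changes of parameter in expansions *)

Section expansions.
Context {R : realType}.
Implicit Types (W c b : R -> R) (s t : R).

Let horner_simp := (@hornerD R, @hornerN R, @hornerZ R, @hornerM R, @hornerXn R,
  @horner_exp R, @hornerC R, @hornerX R).

Lemma isbigO_le N (f g : R -> R) : (forall s, `|f s| <= `|g s|) ->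
  isbigO N g -> isbigO N f.
Proof. by move=> fg [C [d d0 H]]; exists C, d => // s /H; exact: le_trans. Qed.

Lemma isbigO_norm N (f : R -> R) : isbigO N f -> isbigO N (fun s => `|f s|).
Proof. by apply: isbigO_le => s; rewrite normr_id. Qed.

Lemma isbigO_small (f : R -> R) e : isbigO 1 f -> 0 < e ->
  exists2 d, 0 < d & forall s, `|s| < d -> `|f s| < e.
Proof.
move=> /isbigO_gt0 [C [d [C0 d0 H]]] e0; exists (Num.min d (e / C)).
  by rewrite lt_min d0 divr_gt0.
move=> s; rewrite lt_min ltr_pdivlMr // => /andP[sd se].
by rewrite (le_lt_trans (H s sd)) // expr1 mulrC.
Qed.

Lemma isbigO_le_near N (f g : R -> R) L :
  (exists2 d, 0 < d & forall s, `|s| < d -> `|f s| <= L * `|g s|) ->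
  isbigO N g -> isbigO N f.
Proof.
move=> [e e0 He] /(isbigOZ L)/isbigO_norm [C [d d0 H]].
exists C, (Num.min d e); first by rewrite lt_min d0.
move=> s; rewrite lt_min => /andP[/H sd /He fs]; apply: le_trans sd.
by rewrite normr_id (le_trans fs) // normrM ler_wpM2r // ler_norm.
Qed.

Lemma isbigO_norm_rV N n (F : R -> 'rV[R]_n) :
  (forall j, isbigO N (fun s => F s 0 j)) -> isbigO N (fun s => `|F s|).
Proof.
move=> FN; have := @isbigO_sum R N 'I_n (index_enum 'I_n) xpredT (fun j s => `|F s 0 j|)
  (fun j _ => isbigO_norm (FN j)).
apply: isbigO_le => s; rewrite normr_id.
rewrite [leRHS]ger0_norm; last by rewrite sumr_ge0.
apply: norm_le_entries => [|i j]; first by rewrite sumr_ge0.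
by rewrite ord1 (bigD1 j) //= lerDl sumr_ge0.
Qed.

(** Telescoping: [f^(n+1) - g^(n+1) = f (f^n - g^n) + (f - g) g^n], where each product gains one
    order. *)
Lemma isbigO_subXX (f g : R -> R) n : isbigO 1 f -> isbigO 1 g ->
  isbigO 2 (fun s => f s - g s) -> isbigO n.+1 (fun s => f s ^+ n - g s ^+ n).
Proof.
move=> f1 g1 fg.
have gX k : isbigO k (fun s => g s ^+ k).
  elim: k => [|k IH]; first exact: isbigO_cst.
  by apply: isbigO_ext (isbigOM g1 IH) => s; rewrite exprS.
elim: n => [|n IH].
  by apply: isbigO_ext (isbigOZ 0 (isbigOX 1)) => s; rewrite !expr0 subrr mul0r.
apply: isbigO_ext (isbigOD (isbigOM f1 IH) (isbigOM fg (gX n))) => s.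
by rewrite !exprS; ring.
Qed.

Lemma isbigO_horner N (p : {poly R}) : isbigO N (fun s => s ^+ N * p.[s]).
Proof.
have p0 : isbigO 0 (horner p) by apply: continuous_isbigO0; exact: continuous_horner.
by rewrite -{1}[N]addn0; apply: isbigOM => //; exact: isbigOX.
Qed.

Lemma isbigO_monomial N (c : R) : isbigO N (fun s => c * s ^+ N).
Proof. by apply: isbigOZ; exact: isbigOX. Qed.

Lemma isbigO_monomialW N M (c : R) : (M <= N)%N -> isbigO M (fun s => c * s ^+ N).
Proof. by move=> MN; apply: isbigOW MN _; exact: isbigO_monomial. Qed.

(** As [W] is O(t) and [c] is O(t^2), the term with [q2] is O(t^5) in the velocity, hence O(t^6) in
    [b]: this is why [q2] does not occur in the coefficients. *)
Lemma primitive_expansion W c b (W1 W2 W3 W4 c2 c3 q0 q1 q2 : R) :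
  isbigO 5 (fun t => W t - (W1 * t + W2 * t ^+ 2 + W3 * t ^+ 3 + W4 * t ^+ 4)) ->
  isbigO 4 (fun t => c t - (c2 * t ^+ 2 + c3 * t ^+ 3)) ->
  (exists2 d, 0 < d & forall t, `|t| < d ->
    is_derive t (1 : R) b (2^-1 * W t * (q0 + q1 * c t + q2 * c t ^+ 2))) ->
  isbigO 6 (fun t => b t - (b 0 + q0 * W1 / 4 * t ^+ 2 + q0 * W2 / 6 * t ^+ 3 +
    (q0 * W3 + q1 * W1 * c2) / 8 * t ^+ 4 +
    (q0 * W4 + q1 * (W1 * c3 + W2 * c2)) / 10 * t ^+ 5)).
Proof.
move=> OW Oc [d d0 Db].
pose rW t := W t - (W1 * t + W2 * t ^+ 2 + W3 * t ^+ 3 + W4 * t ^+ 4).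
pose rc t := c t - (c2 * t ^+ 2 + c3 * t ^+ 3).
have Oc2 : isbigO 2 c.
  have Oc2 : isbigO 2 rc by exact: (@isbigOW _ 4).
  have := isbigOD Oc2 (isbigOD (isbigO_monomial 2 c2) (@isbigO_monomialW 3 2 c3 isT)).
  by apply: isbigO_ext => t; rewrite subrK.
pose Wp t := W1 * t + W2 * t ^+ 2 + W3 * t ^+ 3 + W4 * t ^+ 4.
have OWp : isbigO 1 Wp.
  do 3 (apply: isbigOD; last exact: isbigO_monomialW).
  exact: (isbigO_monomial 1 W1).
pose Q t := q0 + q1 * c t + q2 * c t ^+ 2.
have OQ : isbigO 0 Q.
  apply: isbigOD; first apply: isbigOD; first exact: isbigO_cst.
    by apply: isbigOZ; exact: isbigOW Oc2.
  apply: isbigOZ; apply: (@isbigOW _ 4) => //; exact: (isbigOM Oc2 Oc2).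
pose e4 := (q0 * W3 + q1 * W1 * c2) / 8.
pose e5 := (q0 * W4 + q1 * (W1 * c3 + W2 * c2)) / 10.
apply: (@isbigO_primitive _ 5 _ (fun t => 2^-1 * W t * Q t -
  (q0 * W1 / 2 * t + q0 * W2 / 2 * t ^+ 2 + 4 * e4 * t ^+ 3 + 5 * e5 * t ^+ 4))).
- exists d => // t /Db Dbt; apply: is_deriveB.
  pose p : {poly R} := (b 0)%:P + (q0 * W1 / 4) *: 'X^2 + (q0 * W2 / 6) *: 'X^3 +
    e4 *: 'X^4 + e5 *: 'X^5.
  have pE s : p.[s] = b 0 + q0 * W1 / 4 * s ^+ 2 + q0 * W2 / 6 * s ^+ 3 +
      e4 * s ^+ 4 + e5 * s ^+ 5.
    by rewrite /p !horner_simp.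
  have -> : (fun t => b 0 + q0 * W1 / 4 * t ^+ 2 + q0 * W2 / 6 * t ^+ 3 +
      e4 * t ^+ 4 + e5 * t ^+ 5) = horner p by apply/funext => s; rewrite pE.
  apply: is_derive_eq (is_derive_poly p t) _.
  rewrite /p !(derivD, derivZ, derivC, derivXn).
  by rewrite !(hornerD, hornerZ, hornerMn, hornerXn, hornerC) /e4 /e5 /=; field.
- by rewrite /=; ring.
have O1 : isbigO 5 (fun t => rW t * Q t) by apply: (isbigOM OW OQ).
have O2 : isbigO 5 (fun t => Wp t * (q1 * rc t)).
  by apply: (isbigOM OWp (isbigOZ q1 Oc)).
have O3 : isbigO 5 (fun t => Wp t * (q2 * (c t * c t))).
  by apply: (isbigOM OWp (isbigOZ q2 (isbigOM Oc2 Oc2))).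
(* The terms of order 5 to 7 in the product of the two Taylor polynomials, with [t ^ 5] divided
   out. *)
pose p : {poly R} := (W2 * c3 + W3 * c2)%:P + (W3 * c3 + W4 * c2) *: 'X +
  (W4 * c3) *: 'X^2.
have O4 := isbigOZ q1 (isbigO_horner 5 p).
apply: isbigO_ext (isbigOZ 2^-1 (isbigOD (isbigOD O1 O2) (isbigOD O3 O4))) => t.
by rewrite /rW /rc /Wp /Q /p !horner_simp /e4 /e5; field.
Qed.

(* The two equations kill the coefficients of [s^3] and [s^5] in the odd part. *)
Lemma odd_part_vanishes (e2 e3 e4 e5 tau tau4 : R) (b : R -> R) (b0 : R) :
  isbigO 6 (fun t => b t - (b0 + e2 * t ^+ 2 + e3 * t ^+ 3 + e4 * t ^+ 4 + e5 * t ^+ 5)) ->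
  4 * e2 * tau + 2 * e3 = 0 ->
  4 * e2 * tau4 + 6 * e3 * tau ^+ 2 + 8 * e4 * tau + 2 * e5 = 0 ->
  isbigO 6 (fun s => b (s + tau * s ^+ 2 + tau4 * s ^+ 4) -
                     b (- s + tau * s ^+ 2 + tau4 * s ^+ 4)).
Proof.
move=> Ob E3 E5.
have OT (x : R) : isbigO 1 (fun s => x * s + tau * s ^+ 2 + tau4 * s ^+ 4).
  do 2 (apply: isbigOD; last exact: isbigO_monomialW).
  exact: (isbigO_monomial 1 x).
have O1 := isbigO_comp Ob (OT 1); have O2 := isbigO_comp Ob (OT (-1)).
pose F : {poly R} := tau%:P + tau4 *: 'X^2.
(* What remains once orders 3 and 5 cancel. The difference is odd, so it starts at [s ^ 7], whence
   the factor ['X] beside [s ^ 6]. *)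
pose p : {poly R} := 'X * ((6 * e3)%:P * ((2 * tau * tau4)%:P + (tau4 ^+ 2) *: 'X^2) +
   (8 * e4 * tau4)%:P + (8 * e4) *: F ^+ 3 + (20 * e5) *: F ^+ 2 +
   (10 * e5) *: F ^+ 4 * 'X^2).
apply: isbigO_ext (isbigOD (isbigOB O1 O2) (isbigO_horner 6 p)) => s.
rewrite !mul1r !mulN1r /p /F !horner_simp.
move: (b _) (b _) => x y.
have E3' : e3 = - (2 * e2 * tau) by lra.
have E5' : e5 = - (2 * e2 * tau4 + 3 * e3 * tau ^+ 2 + 4 * e4 * tau) by lra.
rewrite E5' E3'; ring.
Qed.

Lemma mobius_denom_gt0 (tau : R) :
  exists2 d, 0 < d & forall s, `|s| < d -> 0 < 1 - tau * s.
Proof.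
have d0 : 0 < `|tau| + 1 by rewrite ltr_wpDl.
exists (`|tau| + 1)^-1; first by rewrite invr_gt0.
move=> s; rewrite -[ltRHS]mul1r ltr_pdivlMr // => sd.
rewrite subr_gt0; apply: le_lt_trans sd; rewrite (le_trans (ler_norm _)) // normrM.
by rewrite mulrC ler_wpM2l // lerDl.
Qed.

Lemma isbigO_mobius_denom (tau : R) : isbigO 0 (fun s => (1 - tau * s)^-1).
Proof.
apply: continuous_isbigO0; apply: continuousV; first by rewrite mulr0 subr0 oner_neq0.
by apply: continuousB; [exact: cst_continuous|exact: mulrl_continuous].
Qed.

Lemma isbigO_mobius (tau : R) : isbigO 1 (fun s => s / (1 - tau * s)).
Proof. exact: (isbigOM (isbigOX 1) (isbigO_mobius_denom tau)). Qed.

Lemma mobius_expansion (e2 e3 e4 e5 tau : R) (b : R -> R) (b0 : R) :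
  isbigO 6 (fun t => b t - (b0 + e2 * t ^+ 2 + e3 * t ^+ 3 + e4 * t ^+ 4 + e5 * t ^+ 5)) ->
  isbigO 6 (fun s => b (s / (1 - tau * s)) -
    (b0 + e2 * s ^+ 2 + (2 * tau * e2 + e3) * s ^+ 3 +
     (3 * tau ^+ 2 * e2 + 3 * tau * e3 + e4) * s ^+ 4 +
     (4 * tau ^+ 3 * e2 + 6 * tau ^+ 2 * e3 + 4 * tau * e4 + e5) * s ^+ 5)).
Proof.
move=> Ob; pose v s := (1 - tau * s)^-1.
have Ov : isbigO 0 v := isbigO_mobius_denom tau.
have OvX n : isbigO 0 (fun s => v s ^+ n).
  elim: n => [|n IH]; first exact: isbigO_cst.
  by apply: isbigO_ext (isbigOM Ov IH) => s; rewrite exprS.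
have O1 := isbigO_comp Ob (isbigO_mobius tau).
have O2 n (p : {poly R}) : isbigO 6 (fun s => s ^+ 6 * p.[s] * v s ^+ n).
  exact: (isbigOM (isbigO_horner 6 p) (OvX n)).
pose x : {poly R} := tau *: 'X.
(* For each [i], [s ^ 6 * pi * v ^ i] is the tail beyond [s ^ 5] of the binomial series of
   [ei * (s * v) ^ i]. *)
pose p2 : {poly R} := (e2 * tau ^+ 4)%:P * (5%:P - 4%:P * x).
pose p3 : {poly R} := (e3 * tau ^+ 3)%:P * (10%:P - 15%:P * x + 6%:P * x ^+ 2).
pose p4 : {poly R} := (e4 * tau ^+ 2)%:P *
  (10%:P - 20%:P * x + 15%:P * x ^+ 2 - 4%:P * x ^+ 3).
pose p5 : {poly R} := (e5 * tau)%:P *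
  (5%:P - 10%:P * x + 10%:P * x ^+ 2 - 5%:P * x ^+ 3 + x ^+ 4).
have := isbigOD O1 (isbigOD (isbigOD (O2 2 p2) (O2 3 p3)) (isbigOD (O2 4 p4) (O2 5 p5))).
apply: isbigO_near; have [d d0 Hd] := mobius_denom_gt0 tau.
exists d => // s /Hd /lt0r_neq0 sd; rewrite /p2 /p3 /p4 /p5 /x /v !horner_simp.
by move: (b _) => y; field.
Qed.

End expansions.

(** * Singular points of the surface *)

Lemma det_mx22 (R : comNzRingType) (M : 'M[R]_2) :
  \det M = M 0 0 * M 1 1 - M 0 1 * M 1 0.
Proof.
rewrite (expand_det_row _ 0) !big_ord_recl big_ord0 /cofactor !det_mx11 !mxE.
have E : lift ord0 ord0 = 1 :> 'I_2 by exact: val_inj.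
rewrite ?E {E}.
have E : lift 0 0 = 1 :> 'I_2 by exact: val_inj.
rewrite ?E {E}.
have E : lift 1 0 = 0 :> 'I_2 by exact: val_inj.
rewrite ?E {E}.
by rewrite /= expr0 expr1 addr0 mul1r mulN1r mulrN.
Qed.

Lemma det_mx33 (R : comNzRingType) (M : 'M[R]_3) :
  \det M = M 0 0 * (M 1 1 * M 2 2 - M 1 2 * M 2 1) -
           M 0 1 * (M 1 0 * M 2 2 - M 1 2 * M 2 0) +
           M 0 2 * (M 1 0 * M 2 1 - M 1 1 * M 2 0).
Proof.
rewrite (expand_det_row _ 0) !big_ord_recl big_ord0 /cofactor !det_mx22 !mxE.
have E : lift ord0 ord0 = 1 :> 'I_2 by exact: val_inj.
rewrite ?E {E}.
have E : lift ord0 ord0 = 1 :> 'I_3 by exact: val_inj.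
rewrite ?E {E}.
have E : lift ord0 1 = 2 :> 'I_3 by exact: val_inj.
rewrite ?E {E}.
have E : lift 0 0 = 1 :> 'I_3 by exact: val_inj.
rewrite ?E {E}.
have E : lift 0 1 = 2 :> 'I_3 by exact: val_inj.
rewrite ?E {E}.
have E : lift 1 0 = 0 :> 'I_3 by exact: val_inj.
rewrite ?E {E}.
have E : lift 1 1 = 2 :> 'I_3 by exact: val_inj.
rewrite ?E {E}.
have E : lift 2 0 = 0 :> 'I_3 by exact: val_inj.
rewrite ?E {E}.
have E : lift 2 1 = 1 :> 'I_3 by exact: val_inj.
rewrite ?E {E}.
by rewrite /= expr0 expr1 sqrrN expr1n; ring.
Qed.

Lemma is_derive_coord_comp (R : realType) (W : normedModType R) n (h : R -> W)
    (x v : 'rV[R]_n) i : derivable h (x 0 i) 1 ->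
  is_derive x v (fun y => h (y 0 i)) (v 0 i *: 'D_1 h (x 0 i)).
Proof.
move=> /derivable1_diffP dh.
have dc : differentiable (fun y : 'rV[R]_n => y 0 i) x by exact: differentiable_coord.
split; first by apply: diff_derivable; exact: differentiable_comp.
rewrite deriveE; last exact: differentiable_comp.
have Dc : 'd (fun y : 'rV[R]_n => y 0 i) x v = v 0 i.
  by rewrite -deriveE //; exact: (congr1 (@^~ x) (derive_coord v i)).
rewrite diff_comp //= Dc [in RHS]deriveE //.
by rewrite -[in LHS](mulr1 (v 0 i)) [LHS]linearZ.
Qed.

Lemma Ck1_sqrt (R : realType) : Ck 1 [set t : R | 0 < t] Num.sqrt.
Proof.
split=> // t t0; apply/derivable1_diffP.
by have [] := is_derive1_sqrt (t0 : 0 < t).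
Qed.

Lemma row3E (R : realType) (a b c : R) :
  (row3 a b c 0 0 = a) * (row3 a b c 0 1 = b) * (row3 a b c 0 2 = c).
Proof. by rewrite !mxE. Qed.

Lemma forall_ord3 (P : 'I_3 -> Prop) : P 0 -> P 1 -> P 2 -> forall j, P j.
Proof.
move=> P0 P1 P2 j; have [->|j0] := eqVneq j 0; first exact: P0.
have [->|j1] := eqVneq j 1; first exact: P1.
suff -> : j = 2 by [].
by apply/val_inj; case: j j0 j1 => -[|[|[]]].
Qed.

Lemma derive1_quotient (R : realType) (F G : R -> R) x dF dG :
  is_derive x (1 : R) F dF -> is_derive x (1 : R) G dG -> G x != 0 ->
  derive1 (fun v => F v / G v) x = (dF * G x - F x * dG) / G x ^+ 2.
Proof.
move=> DF DG G0; pose V v := (G v)^-1.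
have DV : is_derive x (1 : R) V (- (G x) ^- 2 * dG) by exact: is_deriveV.
have [_ H] := is_deriveM DF DV.
have -> : (fun v => F v / G v) = F * V by [].
by rewrite derive1E H /V /GRing.scale /=; field.
Qed.

Lemma forall_ord2 (P : 'I_2 -> Prop) : P 0 -> P 1 -> forall j, P j.
Proof.
move=> P0 P1 j; have [->|j0] := eqVneq j 0; first exact: P0.
suff -> : j = 1 by [].
by apply/val_inj; case: j j0 => -[|[|]].
Qed.

Lemma Cinf_primitive (R : realType) (U : set R) (F h : R -> R) : open U ->
  (forall x, U x -> is_derive x (1 : R) F (h x)) -> Cinf U h -> Cinf U F.
Proof.
move=> oU DF Ch; case=> [//|k]; split=> [x /DF [dF _]|v]; first exact/derivable1_diffP.
apply: Ck_eq (CkZ v oU (Ch k)) => // x /DF [dF DFx].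
by rewrite derive_scale // DFx.
Qed.

Lemma derive1n_shift (R : realType) (h : R -> R) v n :
  derive1n n (fun t => h (v + t)) = fun t => derive1n n h (v + t).
Proof.
elim: n h => [//|n IH] h; rewrite !derive1Sn -IH; congr (derive1n n _).
apply/funext => t; rewrite /derive1.
set d := (fun _ : R => _); set d' := (fun _ : R => _); suff -> : d = d' by [].
by apply/funext => s; rewrite /d /d' addrCA.
Qed.

Lemma open_shift (R : realType) (U : set R) v : open U -> open [set t | U (v + t)].
Proof.
move=> oU; apply: norm_open => t /= /(open_norm oU) [r r0 Hr]; exists r => // s st.
by apply: Hr; rewrite opprD addrACA subrr add0r.
Qed.

Lemma Cinf_shift (R : realType) (U : set R) (h : R -> R) v : open U -> Cinf U h ->
  Cinf [set t | U (v + t)] (fun t => h (v + t)).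
Proof.
move=> oU Ch k; have oS := @open_shift R U v oU.
apply: (@Ck_comp1 _ _ _ _ U (fun t => v + t)) => //.
by apply: CkD => //; [exact: Ck_cst|exact: Cinf_id].
Qed.

Lemma taylor_shift (R : realType) (U : set R) (h : R -> R) v N : open U -> U v ->
  Cinf U h -> isbigO N (fun t => h (v + t) -
    \sum_(i < N) derive1n i h v / i`!%:R * t ^+ i).
Proof.
move=> oU Uv Ch; have U0 : [set t | U (v + t)] 0 by rewrite /= addr0.
have := taylorP N (open_shift (v := v) oU) U0 (@Cinf_shift R U h v oU Ch).
apply: isbigO_ext => t; rewrite horner_poly; congr (_ - _); apply: eq_bigr => i _.
by rewrite derive1n_shift addr0.
Qed.

Lemma taylor_coef5 (R : realType) (U : set R) (h : R -> R) (a0 a2 a3 a4 a5 : R) :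
  open U -> U 0 -> Cinf U h ->
  isbigO 6 (fun s => h s - (a0 + a2 * s ^+ 2 + a3 * s ^+ 3 + a4 * s ^+ 4 + a5 * s ^+ 5)) ->
  [/\ derive1n 1 h 0 = 0, derive1n 2 h 0 / 2 = a2, derive1n 3 h 0 / 6 = a3 &
      derive1n 5 h 0 / 120 = a5].
Proof.
move=> oU U0 Ch O6; pose c := [:: a0; 0; a2; a3; a4; a5].
have E : taylor h 6 = \poly_(i < 6) c`_i.
  apply: (taylor_unique oU U0 Ch (size_poly _ _)).
  apply: isbigO_ext O6 => s; rewrite horner_poly !big_ord_recr big_ord0 /=; ring.
have C i : (i < 6)%N -> derive1n i h 0 / i`!%:R = c`_i.
  by move=> i6; have /polyP/(_ i) := E; rewrite !coef_poly i6.
split; [|exact: (C 2%N)|exact: (C 3%N)|exact: (C 5%N)].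
by have := C 1%N isT; rewrite divr1.
Qed.

Lemma open_pos (R : realType) (V : normedModType R) (F : V -> R) :
  Ck 1 setT F -> open [set x | 0 < F x].
Proof.
move=> [dF _]; rewrite (_ : [set _ | _] = F @^-1` [set t | 0 < t]) //.
by apply: open_comp; [move=> x _; exact/differentiable_continuous/dF|exact: open_gt].
Qed.

Lemma is_derive_entry (R : realType) n (F : R -> 'rV[R]_n) t (D : 'rV[R]_n) j :
  is_derive t (1 : R) F D -> is_derive t (1 : R) (fun t => F t 0 j) (D 0 j).
Proof.
move=> [dF <-]; have /derivable_mxP/(_ 0 j) dj := dF.
by split => //; rewrite derive_mx // mxE.
Qed.

(** Iterated directional derivatives along [v] are exactly the derivatives of the restriction to the
    line, so no Frechet differentiability of [F] enters. *)
Lemma smooth_on_line (R : realType) n m (U : set 'rV[R]_n) (F : 'rV[R]_n -> 'rV[R]_m)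
    x v j : open U -> smooth_on U F ->
  open [set t : R | U (x + t *: v)] /\
  Cinf [set t : R | U (x + t *: v)] (fun t => F (x + t *: v) 0 j).
Proof.
move=> oU sF; set S := [set t | _].
have oS : open S.
  apply: norm_open => t /(open_norm oU) [r r0 Hr]; exists (r / (`|v| + 1)).
    by rewrite divr_gt0 // ltr_wpDl.
  move=> s; rewrite ltr_pdivlMr ?ltr_wpDl // => st; apply: Hr.
  rewrite opprD addrACA subrr add0r -scalerBl normrZ; apply: le_lt_trans st.
  by rewrite ler_wpM2l // lerDl.
split=> // k; rewrite -[F]/(Defs.iterD [::] F).
elim: k [::] => [//|k IH] vs.
have D t : S t -> is_derive t (1 : R) (fun t => Defs.iterD vs F (x + t *: v) 0 j)
    (Defs.iterD (v :: vs) F (x + t *: v) 0 j).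
  move=> St; apply: (is_derive_entry j (F := fun t => Defs.iterD vs F (x + t *: v))).
  by apply: is_derive_line; have [_] := sF vs _ St; apply.
split=> [t /D [dt _]|w]; first exact/derivable1_diffP.
apply: Ck_eq (CkZ w oS (IH (v :: vs))) => // t /D [dt Dt].
by rewrite derive_scale // Dt.
Qed.

Section surface.
Context {R : realType}.
Variables (I J : set R) (g1 w1 g2 w2 : R -> R) (alpha beta : R -> 'rV[R]_3)
  (f : 'rV[R]_2 -> 'rV[R]_3) (p : 'rV[R]_2).

Let A u := (2^-1 * w1 u) *: row3 (- 1 - g1 u ^+ 2) (1 - g1 u ^+ 2) (2 * g1 u).
Let B v := (2^-1 * w2 v) *: row3 (1 + g2 v ^+ 2) (1 - g2 v ^+ 2) (- (2 * g2 v)).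

Hypotheses (oI : open I) (oJ : open J)
  (Cg1 : Cinf I g1) (Cw1 : Cinf I w1) (Cg2 : Cinf J g2) (Cw2 : Cinf J w2)
  (Da : forall u, I u -> is_derive u 1 alpha (A u))
  (Db : forall v, J v -> is_derive v 1 beta (B v))
  (fE : forall x : 'rV[R]_2, I (x 0 0) -> J (x 0 1) ->
    f x = alpha (x 0 0) + beta (x 0 1))
  (Ip : I (p 0 0)) (Jp : J (p 0 1)).

Definition domain := [set x : 'rV[R]_2 | I (x 0 0) /\ J (x 0 1)].

Lemma open_domain : open domain.
Proof.
apply: norm_open => x [Ix Jx].
have [r r0 Hr] := open_norm oI Ix; have [s s0 Hs] := open_norm oJ Jx.
exists (Num.min r s); first by rewrite lt_min r0.
move=> y; rewrite lt_min => /andP[yr ys]; split.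
  by apply: Hr; apply: le_lt_trans yr; have := entry_le_norm (y - x) 0 0; rewrite !mxE.
by apply: Hs; apply: le_lt_trans ys; have := entry_le_norm (y - x) 0 1; rewrite !mxE.
Qed.

Lemma near_domain (x : 'rV[R]_2) (P : 'rV[R]_2 -> Prop) : domain x ->
  (forall y, domain y -> P y) -> \forall y \near x, P y.
Proof.
move=> Dx H; apply/near_norm; have [r r0 Hr] := open_norm open_domain Dx.
by exists r => // y /Hr; exact: H.
Qed.

Lemma is_derive_f x v : domain x ->
  is_derive x v f (v 0 0 *: A (x 0 0) + v 0 1 *: B (x 0 1)).
Proof.
move=> Dx; have [Ix Jx] := Dx.
have Dal := Da Ix; have Dbe := Db Jx.
have D1 := is_derive_coord_comp v (@ex_derive _ _ _ _ _ _ _ Dal).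
have D2 := is_derive_coord_comp v (@ex_derive _ _ _ _ _ _ _ Dbe).
rewrite (@derive_val _ _ _ _ _ _ _ Dal) in D1.
rewrite (@derive_val _ _ _ _ _ _ _ Dbe) in D2.
have D12 := is_deriveD D1 D2.
apply: near_eq_is_derive D12.
by apply: near_domain Dx _ => y [Iy Jy]; rewrite fE.
Qed.

Lemma derive_f_u x : domain x -> derive f x (e_u R) = A (x 0 0).
Proof.
by move=> /(is_derive_f (e_u R)) [_ ->]; rewrite !mxE /= scale1r scale0r addr0.
Qed.

Lemma derive_f_v x : domain x -> derive f x (e_v R) = B (x 0 1).
Proof.
by move=> /(is_derive_f (e_v R)) [_ ->]; rewrite !mxE /= scale1r scale0r add0r.
Qed.

(** The squared Euclidean length of the vector that is normalized in [unit_normal]. *)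
Let N (x : 'rV[R]_2) := (1 - g1 (x 0 0) * g2 (x 0 1)) ^+ 2 +
  2 * (g1 (x 0 0) + g2 (x 0 1)) ^+ 2.

Lemma normal_gt0 (x : 'rV[R]_2) : 0 < N x.
Proof.
rewrite /N; move: (g1 _) (g2 _) => a b.
have -> : (1 - a * b) ^+ 2 + 2 * (a + b) ^+ 2 =
    1 + ((a + b) ^+ 2 + a ^+ 2 + b ^+ 2 + (a * b) ^+ 2) by ring.
by rewrite ltr_pwDl // !addr_ge0 // sqr_ge0.
Qed.

Let K (x : 'rV[R]_2) := - 2^-1 * w1 (x 0 0) * (1 - g1 (x 0 0) * g2 (x 0 1)) * N x *
  (Num.sqrt (N x))^-1.

Lemma lambda_fnE (x : 'rV[R]_2) : domain x -> lambda_fn f g1 g2 x = K x * w2 (x 0 1).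
Proof.
move=> Dx; rewrite /lambda_fn derive_f_u // derive_f_v // det_mx33 !mxE /=.
rewrite /K /unit_normal -/(N x); move: (Num.sqrt _)^-1 => q.
by rewrite /N; field.
Qed.

Lemma Ck_coord0 k (h : R -> R) : Cinf I h -> Ck k domain (fun x : 'rV[R]_2 => h (x 0 0)).
Proof.
move=> Ch; apply: (@Ck_comp1 _ _ k domain I (fun x : 'rV[R]_2 => x 0 0) h).
- exact: open_domain.
- exact: Ch.
- exact: Ck_coord.
- by move=> x [].
Qed.

Lemma Ck_coord1 k (h : R -> R) : Cinf J h -> Ck k domain (fun x : 'rV[R]_2 => h (x 0 1)).
Proof.
move=> Ch; apply: (@Ck_comp1 _ _ k domain J (fun x : 'rV[R]_2 => x 0 1) h).
- exact: open_domain.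
- exact: Ch.
- exact: Ck_coord.
- by move=> x [].
Qed.

Lemma Ck_normal k : Ck k domain N.
Proof.
have oD := open_domain.
apply: CkD => //; [apply: CkX => //; apply: CkB => //; first exact: Ck_cst|
  apply: CkZ => //; apply: CkX => //; apply: CkD => //].
by apply: CkM => //; [exact: Ck_coord0|exact: Ck_coord1].
all: by [exact: Ck_coord0|exact: Ck_coord1].
Qed.

Lemma Ck1_sqrt_normal : Ck 1 domain (fun x : 'rV[R]_2 => (Num.sqrt (N x))^-1).
Proof.
apply: CkV; first exact: open_domain.
  by move=> x _; rewrite gt_eqF // sqrtr_gt0 normal_gt0.
apply: (Ck_comp1 open_domain (@Ck1_sqrt R) (Ck_normal 1)).
by move=> x _; exact: normal_gt0.
Qed.

(** Since [lambda = K * w2] and [w2] vanishes at [p], the differential of [lambda] is [K p] times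
    that of [w2]; it is nonzero only if every factor is. *)
Lemma nondegenerate_data : w2 (p 0 1) = 0 ->
  derive (lambda_fn f g1 g2) p (e_u R) != 0 \/
    derive (lambda_fn f g1 g2) p (e_v R) != 0 ->
  [/\ w1 (p 0 0) != 0, 1 - g1 (p 0 0) * g2 (p 0 1) != 0 & derive1 w2 (p 0 1) != 0].
Proof.
move=> w20 H; have oD := open_domain; have Dp : domain p by [].
have CK : Ck 1 domain K.
  have C1 := CkB oD (Ck_cst 1 domain 1) (CkM oD (Ck_coord0 1 Cg1) (Ck_coord1 1 Cg2)).
  have C2 := CkM oD (CkM oD (Ck_cst 1 domain (- 2^-1)) (Ck_coord0 1 Cw1)) C1.
  exact: (CkM oD (CkM oD C2 (Ck_normal 1)) Ck1_sqrt_normal).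
have DL v : derive (lambda_fn f g1 g2) p v = K p * (v 0 1 * derive1 w2 (p 0 1)).
  pose G (x : 'rV[R]_2) := w2 (x 0 1).
  rewrite (@near_eq_derive R 'rV[R]_2 R _ (K * G)); last first.
    by apply: near_domain Dp _ => y; exact: lambda_fnE.
  have dw : derivable w2 (p 0 1) 1.
    by apply: diff_derivable; exact: Cinf_differentiable Cw2 Jp.
  have DG : is_derive p v G (v 0 1 *: 'D_1 w2 (p 0 1)) by exact: is_derive_coord_comp.
  have dK : derivable K p v by apply: diff_derivable; exact: CK.1.
  have [_ ->] := is_deriveM (derivableP dK) DG.
  by rewrite /G w20 scale0r addr0 derive1E.
have : K p * derive1 w2 (p 0 1) != 0.
  by move: H; rewrite !DL !mxE /= mul0r mulr0 eqxx mul1r; case.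
by rewrite /K !mulf_eq0 !negb_or -!andbA => /and5P[_ -> -> _ /andP[]].
Qed.

(** Where [w2] vanishes the [v]-row of the Jacobian of [f] is zero, and [w1 <> 0] keeps the [u]-row
    nonzero. So [(f, n)] is an immersion as soon as [n_v] is nonzero, and [g2' <> 0] ensures
    this. *)
Lemma not_front_data : w2 (p 0 1) = 0 -> w1 (p 0 0) != 0 ->
  ~ front_at f g1 g2 p -> derive1 g2 (p 0 1) = 0.
Proof.
move=> w20 w10 nf; apply: contra_notP nf => /eqP g2'; rewrite /front_at.
have oD := open_domain; have Dp : domain p by [].
set M := row_mx _ _; suff : row_free M by rewrite /row_free => /eqP.
apply: inj_row_free => v; rewrite mul_mx_row => /eqP; rewrite row_mx_eq0 => /andP[].
rewrite -(hsubmxK v); set a := lsubmx v; set b := rsubmx v.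
rewrite !mul_row_col derive_f_u // derive_f_v //.
have -> : B (p 0 1) = 0 by rewrite /B w20 mulr0 scale0r.
rewrite mulmx0 addr0 => /eqP aA.
have a0 : a = 0.
  apply/rowP => i; rewrite !ord1 [RHS]mxE.
  have E j : a 0 0 * A (p 0 0) 0 j = 0.
    by have /rowP/(_ j) := aA; rewrite mxE big_ord1 => ->; rewrite mxE.
  move: (a 0 0) (E 0) (E 1) => y; rewrite !mxE /= => H0 H1.
  (* The first two entries of [A] differ by [w1]. *)
  have : y * w1 (p 0 0) = 0 by lra.
  by move/eqP; rewrite mulf_eq0 (negPf w10) orbF => /eqP.
rewrite a0 mul0mx add0r => /eqP bn.
have b0 : b = 0.
  apply/rowP => i; rewrite !ord1 [RHS]mxE; apply: contraTeq isT => b0 /=.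
  pose rho (x : 'rV[R]_2) := (Num.sqrt (N x))^-1.
  have drho : derivable rho p (e_v R).
    by apply: diff_derivable; exact: Ck1_sqrt_normal.1.
  have rho0 : rho p != 0 by rewrite invr_eq0 gt_eqF // sqrtr_gt0 normal_gt0.
  have C0 : Ck 1 domain (fun x : 'rV[R]_2 => g1 (x 0 0)) by exact: Ck_coord0.
  have C1 : Ck 1 domain (fun x : 'rV[R]_2 => g2 (x 0 1)) by exact: Ck_coord1.
  pose r' := 'D_(e_v R) rho p; pose g' := derive1 g2 (p 0 1).
  have d1 (h : R -> R) : derivable h (p 0 0) 1 ->
      is_derive p (e_v R) (fun x : 'rV[R]_2 => h (x 0 0)) 0.
    move=> dh; have := is_derive_coord_comp (e_v R) dh.
    by rewrite !mxE /= scale0r.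
  pose G1 (x : 'rV[R]_2) := g1 (x 0 0); pose G2 (x : 'rV[R]_2) := g2 (x 0 1).
  have dg1 : is_derive p (e_v R) G1 0.
    by apply: d1; apply: diff_derivable; exact: Cinf_differentiable Cg1 Ip.
  have dg2 : is_derive p (e_v R) G2 g'.
    have dh : derivable g2 (p 0 1) 1.
      by apply: diff_derivable; exact: Cinf_differentiable Cg2 Jp.
    have := is_derive_coord_comp (e_v R) dh.
    by rewrite !mxE /= scale1r /g' derive1E.
  pose m (x : 'rV[R]_2) := row3 (G1 x + G2 x) (- G1 x + G2 x) (1 + G1 x * G2 x).
  pose mj j (x : 'rV[R]_2) := m x 0 j.
  have dm j : is_derive p (e_v R) (mj j) (row3 g' g' (g1 (p 0 0) * g') 0 j).
    have dab : is_derive p (e_v R) (G1 * G2) (g1 (p 0 0) * g').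
      by apply: is_derive_eq (is_deriveM dg1 dg2) _; rewrite scaler0 addr0.
    move: j; apply: forall_ord3; rewrite row3E.
    - rewrite (_ : mj 0 = G1 + G2); last by apply/funext => x; rewrite /mj row3E.
      by apply: is_derive_eq (is_deriveD dg1 dg2) _; rewrite add0r.
    - rewrite (_ : mj 1 = - G1 + G2); last by apply/funext => x; rewrite /mj row3E.
      by apply: is_derive_eq (is_deriveD (is_deriveN dg1) dg2) _; rewrite oppr0 add0r.
    - rewrite (_ : mj 2 = cst 1 + G1 * G2); last by apply/funext => x; rewrite /mj row3E.
      by apply: is_derive_eq (is_deriveD (is_derive_cst _ _ _) dab) _; rewrite add0r.
  have dn j : is_derive p (e_v R) (fun x => unit_normal g1 g2 x 0 j)
      (rho p * row3 g' g' (g1 (p 0 0) * g') 0 j + m p 0 j * r').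
    have -> : (fun x => unit_normal g1 g2 x 0 j) = rho * mj j.
      apply/funext => x; transitivity (rho x * mj j x) => //.
      by rewrite /unit_normal mxE.
    exact: (is_deriveM (derivableP drho) (dm j)).
  have Dn j : rho p * row3 g' g' (g1 (p 0 0) * g') 0 j + m p 0 j * r' = 0.
    have dnv : derivable (unit_normal g1 g2) p (e_v R).
      by apply/derivable_mxP => k l; rewrite ord1; have [] := dn l.
    have [_ dnE] := dn j.
    have nE : derive (unit_normal g1 g2) p (e_v R) 0 j =
        derive (fun x => unit_normal g1 g2 x 0 j) p (e_v R).
      by rewrite derive_mx // mxE.
    have /rowP/(_ j) := bn; rewrite mxE big_ord1 nE dnE [RHS]mxE => /eqP.
    by rewrite mulf_eq0 (negPf b0) => /eqP.
  (* [z (1, 1, x)] and [(x + y, - x + y, 1 + x y)] are independent for [z <> 0]. The derivative of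
     the normalizing factor is never computed: it is the unknown [r]. *)
  have alg (x y q z r : R) : q != 0 -> z != 0 -> q * z + (x + y) * r = 0 ->
      q * z + (- x + y) * r = 0 -> q * (x * z) + (1 + x * y) * r = 0 -> False.
    move=> q0 z0 E0 E1 E2; have R1 : x * r = 0 by lra.
    have R2 : (x ^+ 2 - 1) * r = 0.
      transitivity (x * (q * z + (x + y) * r) - (q * (x * z) + (1 + x * y) * r)); first by ring.
      by rewrite E0 E2 mulr0 subrr.
    have r0 : r = 0.
      have -> : r = x * (x * r) - (x ^+ 2 - 1) * r by ring.
      by rewrite R1 R2 mulr0 subrr.
    by move: E0; rewrite r0 mulr0 addr0 => /eqP; rewrite mulf_eq0 (negPf q0) (negPf z0).
  have D0 := Dn 0; have D1 := Dn 1; have D2 := Dn 2; rewrite /m !row3E /G1 /G2 in D0 D1 D2.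
  by case: (alg _ _ _ _ _ rho0 g2' D0 D1 D2).
by rewrite b0 row_mx0.
Qed.

End surface.

(** * The criterion *)

Section normal_form.
Context {R : realType}.
Variables (I J : set R) (g1 w1 g2 w2 : R -> R) (alpha beta : R -> 'rV[R]_3)
  (f : 'rV[R]_2 -> 'rV[R]_3) (p : 'rV[R]_2).

Let A u := (2^-1 * w1 u) *: row3 (- 1 - g1 u ^+ 2) (1 - g1 u ^+ 2) (2 * g1 u).
Let B v := (2^-1 * w2 v) *: row3 (1 + g2 v ^+ 2) (1 - g2 v ^+ 2) (- (2 * g2 v)).
Local Notation domain := (domain I J).

Hypotheses (oI : open I) (oJ : open J)
  (Cg1 : Cinf I g1) (Cw1 : Cinf I w1) (Cg2 : Cinf J g2) (Cw2 : Cinf J w2)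
  (Da : forall u, I u -> is_derive u 1 alpha (A u))
  (Db : forall v, J v -> is_derive v 1 beta (B v))
  (fE : forall x : 'rV[R]_2, I (x 0 0) -> J (x 0 1) ->
    f x = alpha (x 0 0) + beta (x 0 1))
  (Ip : I (p 0 0)) (Jp : J (p 0 1)).

Local Notation u0 := (p 0 0).
Local Notation v0 := (p 0 1).
(* In terms of [c = g2 - b0], the null direction [(1 + g2^2, 1 - g2^2, - 2 g2)] is
   [q0 + c q1 + O(c^2)]; [Wi], [ci] are Taylor coefficients of [w2], [g2] at [v0], and
   [ei] those of [beta].  [tau] removes the cubic term of [beta], and [mu / 30] is
   then the [q1]-component of the coefficient of [s^5]. *)
Let b0 := g2 v0.
Let q0 : 'rV[R]_3 := row3 (1 + b0 ^+ 2) (1 - b0 ^+ 2) (- (2 * b0)).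
Let q1 : 'rV[R]_3 := row3 (2 * b0) (- (2 * b0)) (- 2).
Let W1 := derive1 w2 v0.
Let W2 := derive1n 2 w2 v0 / 2.
Let W3 := derive1n 3 w2 v0 / 6.
Let W4 := derive1n 4 w2 v0 / 24.
Let c2 := derive1n 2 g2 v0 / 2.
Let c3 := derive1n 3 g2 v0 / 6.
Let mu := 3 * W1 * c3 - 2 * W2 * c2.
Let e2 j := q0 0 j * W1 / 4.
Let e3 j := q0 0 j * W2 / 6.
Let e4 j := (q0 0 j * W3 + q1 0 j * W1 * c2) / 8.
Let e5 j := (q0 0 j * W4 + q1 0 j * (W1 * c3 + W2 * c2)) / 10.
Let tau := - (W2 / (3 * W1)).

Hypotheses (w10 : w1 u0 != 0) (ab1 : 1 - g1 u0 * g2 v0 != 0) (W10 : W1 != 0)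
  (w20 : w2 v0 = 0) (g2'0 : derive1 g2 v0 = 0).

Lemma quotient_condition :
  derive1 (fun v => derive1 (derive1 g2) v / derive1 w2 v) v0 != 0 <-> mu != 0.
Proof.
have Cg := Cinf_derive1 (Cinf_derive1 Cg2); have Cw := Cinf_derive1 Cw2.
have E2 : derive1 (derive1 g2) v0 = 2 * c2 by rewrite /c2 mulrC divfK.
have E3 : derive1 (derive1 (derive1 g2)) v0 = 6 * c3 by rewrite /c3 mulrC divfK.
have E1 : derive1 (derive1 w2) v0 = 2 * W2 by rewrite /W2 mulrC divfK.
rewrite (derive1_quotient (Cinf_is_derive Cg Jp) (Cinf_is_derive Cw Jp) W10).
rewrite E1 E2 E3 -/W1.
have -> : (6 * c3 * W1 - 2 * c2 * (2 * W2)) / W1 ^+ 2 = mu * (2 / W1 ^+ 2).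
  by rewrite /mu; field.
by rewrite mulf_eq0 negb_or mulf_neq0 ?andbT // invr_eq0 expf_neq0.
Qed.

Lemma Cinf_A j : Cinf I (fun u => A u 0 j).
Proof.
have C2 k : Ck k I (fun u => 2^-1 * w1 u) by apply: CkZ.
have Csq k : Ck k I (fun u => g1 u ^+ 2) by apply: CkX.
move=> k; move: j; apply: forall_ord3; (apply: (@Ck_eq _ _ _ _ (fun u => 2^-1 * w1 u * _)) => //;
  first by move=> u _; rewrite !mxE).
- by apply: CkM => //; apply: CkB => //; exact: Ck_cst.
- by apply: CkM => //; apply: CkB => //; exact: Ck_cst.
- by apply: CkM => //; exact: CkZ.
Qed.

Lemma Cinf_B j : Cinf J (fun v => B v 0 j).
Proof.
have C2 k : Ck k J (fun u => 2^-1 * w2 u) by apply: CkZ.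
have Csq k : Ck k J (fun u => g2 u ^+ 2) by apply: CkX.
move=> k; move: j; apply: forall_ord3; (apply: (@Ck_eq _ _ _ _ (fun u => 2^-1 * w2 u * _)) => //;
  first by move=> u _; rewrite !mxE).
- by apply: CkM => //; apply: CkD => //; exact: Ck_cst.
- by apply: CkM => //; apply: CkB => //; exact: Ck_cst.
- apply: CkM => //; apply: (@Ck_eq _ _ _ _ (fun u => (-1) * (2 * g2 u))) => //.
    by move=> u _; rewrite mulN1r.
  by apply: CkZ => //; exact: CkZ.
Qed.

Lemma Cinf_alpha j : Cinf I (fun u => alpha u 0 j).
Proof.
apply: Cinf_primitive (Cinf_A j) => // u /Da; exact: is_derive_entry.
Qed.

Lemma Cinf_beta j : Cinf J (fun v => beta v 0 j).
Proof.
apply: Cinf_primitive (Cinf_B j) => // v /Db; exact: is_derive_entry.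
Qed.

Lemma beta_expansion j : isbigO 6 (fun t => beta (v0 + t) 0 j -
  (beta v0 0 j + e2 j * t ^+ 2 + e3 j * t ^+ 3 + e4 j * t ^+ 4 + e5 j * t ^+ 5)).
Proof.
(* The expansion of the null direction in powers of [g2 - b0] is exact with this last vector. *)
pose q2 : 'rV[R]_3 := row3 1 (-1) 0.
have OW : isbigO 5 (fun t => w2 (v0 + t) - (W1 * t + W2 * t ^+ 2 + W3 * t ^+ 3 + W4 * t ^+ 4)).
  apply: isbigO_ext (taylor_shift 5 oJ Jp Cw2) => t.
  rewrite !big_ord_recr big_ord0 /= w20 /W1 /W2 /W3 /W4 !factS fact0 /=.
  by rewrite mul0r mul0r !add0r divr1.
have Oc : isbigO 4 (fun t => (g2 (v0 + t) - b0) - (c2 * t ^+ 2 + c3 * t ^+ 3)).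
  apply: isbigO_ext (taylor_shift 4 oJ Jp Cg2) => t.
  rewrite !big_ord_recr big_ord0 /= g2'0 /c2 /c3 /b0 /=.
  rewrite expr0 divr1 mulr1 mul0r mul0r add0r addr0 -addrA opprD addrA.
  by [].
have Db' : exists2 d, 0 < d & forall t, `|t| < d -> is_derive t (1 : R)
    (fun t => beta (v0 + t) 0 j)
    (2^-1 * w2 (v0 + t) * (q0 0 j + q1 0 j * (g2 (v0 + t) - b0) +
      q2 0 j * (g2 (v0 + t) - b0) ^+ 2)).
  have [d d0 Hd] := open_norm oJ Jp; exists d => // t td.
  have Jt : J (v0 + t) by apply: Hd; rewrite addrC addKr.
  have Dj := is_derive_entry j (Db Jt).
  have Ds : is_derive t (1 : R) (fun t => v0 + t) 1.
    by apply: is_derive_eq (is_deriveD (is_derive_cst _ _ _) (is_derive_id _ _)) _; rewrite add0r.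
  apply: is_derive_eq (is_derive1_comp Dj Ds) _; rewrite mulr1.
  move: j {Dj}; apply: forall_ord3; rewrite /B /q0 /q1 /q2 !mxE /=; ring.
have := primitive_expansion OW Oc Db'.
by apply: isbigO_ext => t; rewrite addr0.
Qed.

Lemma mobius_normal_form : exists (E D : 'I_3 -> R -> R) d,
  [/\ 0 < d, forall j, Cinf [set X | `|X| < d] (E j) /\ Cinf [set X | `|X| < d] (D j),
    forall j, derive1 (E j) 0 = e2 j,
    forall j, D j 0 = 4 * tau ^+ 3 * e2 j + 6 * tau ^+ 2 * e3 j + 4 * tau * e4 j + e5 j &
    forall j s, s ^+ 2 < d ->
      beta (v0 + s / (1 - tau * s)) 0 j = E j (s ^+ 2) + s ^+ 5 * D j (s ^+ 2)].
Proof.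
have [r r0 Hr] := open_norm oJ Jp.
have [d1 d10 Hd1] := isbigO_small (isbigO_mobius tau) r0.
have [d2 d20 Hd2] := mobius_denom_gt0 tau.
pose e := Num.min d1 d2; have e0 : 0 < e by rewrite lt_min d10.
pose h j s := beta (v0 + s / (1 - tau * s)) 0 j.
have oS : open [set s : R | `|s| < e] by exact: open_absball.
have Ch j : Cinf [set s | `|s| < e] (h j).
  move=> k; apply: (@Ck_comp1 R R k [set s : R | `|s| < e] J (fun s => v0 + s / (1 - tau * s))
    (fun v => beta v 0 j)) => //.
  - exact: Cinf_beta.
  - apply: CkD => //; first exact: Ck_cst.
    apply: CkM => //; first exact: Cinf_id.
    apply: CkV => //.
      by move=> s /=; rewrite lt_min => /andP[_ /Hd2 /lt0r_neq0].
    by apply: CkB => //; [exact: Ck_cst|apply: CkZ => //; exact: Cinf_id].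
  - move=> s /=; rewrite lt_min => /andP[/Hd1 sr _].
    by apply: Hr; rewrite addrC addKr.
have S0 : [set s : R | `|s| < e] 0 by rewrite /= normr0.
have coef j := taylor_coef5 oS S0 (Ch j) (mobius_expansion tau (beta_expansion j)).
have A3 j : 2 * tau * e2 j + e3 j = 0 by rewrite /e2 /e3 /tau; field.
have odd0 j i : (i < 2)%N -> derive1n i.*2.+1 (h j) 0 = 0.
  have [H1 _ H3 _] := coef j; case: i => [|[|//]] _; first exact: H1.
  by move/eqP: H3; rewrite A3 mulf_eq0 invr_eq0 pnatr_eq0 orbF => /eqP.
have nf j := whitney_even_odd e0 (Ch j) (odd0 j).
(* The two functions and the radius are packed into a triple, because [choice] yields one function
   of the coordinate [j]. *)
have [ED HED] := choice (fun j => (fun P : exists EDd : (R -> R) * (R -> R) * R,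
   [/\ 0 < EDd.2, Cinf [set X | `|X| < EDd.2] EDd.1.1 /\ Cinf [set X | `|X| < EDd.2] EDd.1.2,
    derive1 EDd.1.1 0 = derive1n 2 (h j) 0 / 2,
    EDd.1.2 0 = derive1n 5 (h j) 0 / 120 &
    forall s, s ^+ 2 < EDd.2 -> h j s = EDd.1.1 (s ^+ 2) + s ^+ 5 * EDd.1.2 (s ^+ 2)] => P)
   (let: ex_intro E (ex_intro D (ex_intro d H)) := nf j in
    ex_intro _ (E, D, d) H)).
pose d := Num.min (ED 0).2 (Num.min (ED 1).2 (ED 2).2).
have dj j : d <= (ED j).2.
  by move: j; apply: forall_ord3; rewrite /d !ge_min lexx ?orbT.
exists (fun j => (ED j).1.1), (fun j => (ED j).1.2), d; split.
- rewrite !lt_min; have [-> _ _ _ _] := HED 0; have [-> _ _ _ _] := HED 1.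
  by have [-> _ _ _ _] := HED 2.
- move=> j; have [_ [CE CD] _ _ _] := HED j.
  by split; [apply: Cinf_sub CE|apply: Cinf_sub CD] => X /= /lt_le_trans; apply.
- move=> j; have [_ _ E1 _ _] := HED j; have [_ E2 _ _] := coef j.
  exact: etrans E1 E2.
- move=> j; have [_ _ _ E1 _] := HED j; have [_ _ _ E2] := coef j.
  exact: etrans E1 E2.
- move=> j s sd; have [_ _ _ _ H] := HED j; apply: H; exact: lt_le_trans (dj j).
Qed.

Lemma sufficiency : mu != 0 -> A_equiv f (@cusp25 R) p 0.
Proof.
move=> mu0; have [E [D [d [d0 CED E'0 D0 betaE]]]] := mobius_normal_form.
have [r r0 Hr] := open_norm oI Ip.
pose U := [set x : 'rV[R]_3 | I (u0 + x 0 0) /\ `|x 0 1| < d].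
pose Psi (x : 'rV[R]_3) : 'rV[R]_3 :=
  \row_j (alpha (u0 + x 0 0) 0 j + E j (x 0 1) + x 0 2 * D j (x 0 1)).
have oU : open U.
  apply: norm_open => x [Ix xd].
  have [s s0 Hs] := open_norm (open_shift (v := u0) oI) Ix.
  have [t t0 Ht] := open_norm (open_absball (e := d)) xd.
  exists (Num.min s t); first by rewrite lt_min s0.
  move=> y; rewrite lt_min => /andP[ys yt]; split.
    by apply: Hs; apply: le_lt_trans ys; have := entry_le_norm (y - x) 0 0; rewrite !mxE.
  by apply: Ht; apply: le_lt_trans yt; have := entry_le_norm (y - x) 0 1; rewrite !mxE.
have U0 : U 0 by rewrite /U /= !mxE addr0 normr0.
have Ca j k : Ck k U (fun x : 'rV[R]_3 => alpha (u0 + x 0 0) 0 j).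
  apply: (@Ck_comp1 _ _ k U [set t | I (u0 + t)] (fun x : 'rV[R]_3 => x 0 0)
    (fun t => alpha (u0 + t) 0 j)) => //.
  - exact: (@Cinf_shift R I (fun u => alpha u 0 j) u0 oI (Cinf_alpha j) k).
  - exact: Ck_coord.
  - by move=> x [].
have Cd k (h : R -> R) : Cinf [set X | `|X| < d] h -> Ck k U (fun x : 'rV[R]_3 => h (x 0 1)).
  move=> Ch; apply: (@Ck_comp1 _ _ k U [set X | `|X| < d] (fun x : 'rV[R]_3 => x 0 1) h) => //.
  - exact: Ck_coord.
  - by move=> x [].
have CPsi j : Cinf U (fun x => Psi x 0 j).
  move=> k; have [CE CD] := CED j.
  apply: (@Ck_eq _ _ _ _ (fun x : 'rV[R]_3 => alpha (u0 + x 0 0) 0 j + E j (x 0 1) +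
    x 0 2 * D j (x 0 1))) => //; first by move=> x _; rewrite mxE.
  apply: CkD => //; first by apply: CkD => //; exact: Cd.
  by apply: CkM => //; [exact: Ck_coord|exact: Cd].
have DPsi j (v : 'rV[R]_3) : derive (fun x => Psi x 0 j) 0 v =
    v 0 0 * A u0 0 j + v 0 1 * e2 j + v 0 2 * D j 0.
  have -> : (fun x => Psi x 0 j) = (fun x : 'rV[R]_3 => alpha (u0 + x 0 0) 0 j) +
      (fun x : 'rV[R]_3 => E j (x 0 1)) +
      (fun x : 'rV[R]_3 => x 0 2) * (fun x : 'rV[R]_3 => D j (x 0 1)).
    by apply/funext => x; rewrite mxE.
  have [CE CD] := CED j.
  have B0 : [set X : R | `|X| < d] ((0 : 'rV[R]_3) 0 1) by rewrite /= mxE normr0.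
  have I0 : [set t | I (u0 + t)] ((0 : 'rV[R]_3) 0 0) by rewrite /= mxE addr0.
  have z i : (0 : 'rV[R]_3) 0 i = 0 by rewrite mxE.
  have Das := Cinf_is_derive (Cinf_shift u0 oI (Cinf_alpha j)) I0.
  have Da' := is_derive_coord_comp v (@ex_derive _ _ _ _ _ _ _ Das).
  have DE := is_derive_coord_comp v (@ex_derive _ _ _ _ _ _ _ (Cinf_is_derive CE B0)).
  have DD := is_derive_coord_comp v (@ex_derive _ _ _ _ _ _ _ (Cinf_is_derive CD B0)).
  have dc : derivable (fun x : 'rV[R]_3 => x 0 2) 0 v.
    by apply: diff_derivable; exact: differentiable_coord.
  have [_ ->] := is_deriveD (is_deriveD Da' DE) (is_deriveM (derivableP dc) DD).
  rewrite (congr1 (@^~ 0) (derive_coord v 2)) !z scale0r add0r /GRing.scale /=.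
  rewrite -!derive1E E'0 [D j 0 * _]mulrC; congr (_ * _ + _ + _).
  rewrite (_ : derive1 _ 0 = derive1 (fun t => alpha t 0 j) u0).
    have [_] := is_derive_entry j (Da Ip); by rewrite derive1E.
  by have /(congr1 (@^~ 0)) := derive1n_shift (fun t => alpha t 0 j) u0 1; rewrite addr0.
have det0 : \det (partials Psi 0) != 0.
  (* The rows are [A u0], [E' 0] and [D 0]. The second is parallel to [q0], so of the third only its
     part [mu / 30] along [q1] counts, and the determinant of the three directions is a multiple of
     [(1 - g1 g2) ^ 2]. *)
  have -> : \det (partials Psi 0) =
      w1 u0 * W1 * (1 - g1 u0 * g2 v0) ^+ 2 * mu / 60.
    rewrite det_mx33 !mxE !DPsi !mxE /= !D0 /e2 /e3 /e4 /e5 /tau /mu !mxE /= /b0.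
    by field.
  by rewrite !mulf_neq0 // ?expf_neq0 // invr_eq0 pnatr_eq0.
have [U' [V [G [[oU' U'0] U'U [oV VP] CG [U'V VU']]]]] := inverse_function oU U0 CPsi det0.
have PsiE x s : domain x -> s = (x 0 1 - v0) / (1 + tau * (x 0 1 - v0)) ->
    0 < 1 + tau * (x 0 1 - v0) -> s ^+ 2 < d ->
    Psi (row3 (x 0 0 - u0) (s ^+ 2) (s ^+ 5)) = f x.
  move=> [Ix Jx] sE pos sd; rewrite fE //; apply/rowP => j; rewrite !mxE /=.
  rewrite subrKC -addrA; congr (_ + _); rewrite -betaE //; congr (beta _ 0 j).
  have nz := lt0r_neq0 pos.
  have E1 : 1 - tau * s = (1 + tau * (x 0 1 - v0))^-1 by rewrite sE; field.
  by rewrite E1 invrK sE divfK // subrKC.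
have row30 (x : R) : x = 0 -> row3 x (0 ^+ 2) (0 ^+ 5) = 0.
  by move=> ->; apply/rowP; apply: forall_ord3; rewrite !mxE /= ?expr0n.
have fp : f p = Psi 0.
  rewrite -(@PsiE p 0) ?row30 ?subrr //; last by rewrite expr0n.
    by rewrite mul0r.
  by rewrite mulr0 addr0.
(* [t / (1 + tau t)] inverts [s / (1 - tau s)]; the two denominators are reciprocal at corresponding
   points, so positivity of one is positivity of the other. *)
pose den (x : 'rV[R]_2) := 1 + tau * (x 0 1 - v0).
pose sg (x : 'rV[R]_2) := (x 0 1 - v0) / den x.
pose phi (x : 'rV[R]_2) : 'rV[R]_2 := \row_(j < 2) [:: x 0 0 - u0; sg x]`_j.
pose den' (y : 'rV[R]_2) := 1 - tau * y 0 1.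
pose psi (y : 'rV[R]_2) : 'rV[R]_2 := \row_(j < 2) [:: u0 + y 0 0; v0 + y 0 1 / den' y]`_j.
pose U1 := [set x | 0 < den x]; pose V1 := [set y | 0 < den' y].
have Cc k (S : set 'rV[R]_2) (j : 'I_2) : Ck k S (fun x : 'rV[R]_2 => x 0 j) := Ck_coord k S j.
have Cden k (S : set 'rV[R]_2) : open S -> Ck k S den.
  move=> oS; apply: (CkD oS (Ck_cst k S 1)); apply: (CkZ tau oS).
  exact: (CkB oS (Cc _ _ _) (Ck_cst _ _ _)).
have Cden' k (S : set 'rV[R]_2) : open S -> Ck k S den'.
  by move=> oS; apply: (CkB oS (Ck_cst k S 1)); apply: (CkZ tau oS).
have oU1 : open U1 by apply: open_pos; apply: Cden; exact: openT.
have oV1 : open V1 by apply: open_pos; apply: Cden'; exact: openT.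
have denp : den p = 1 by rewrite /den subrr mulr0 addr0.
have sgp : sg p = 0 by rewrite /sg subrr mul0r.
have ldphi : loc_diffeo phi p.
  exists U1, V1, psi; split.
  - by split=> //; rewrite /U1 /= denp ltr01.
  - split=> //; apply: smooth_on_rV => //; apply: forall_ord2 => k.
      apply: (Ck_eq oU1 _ (CkB oU1 (Cc k U1 0) (Ck_cst k U1 u0))) => x _.
      by rewrite mxE.
    apply: (Ck_eq oU1 _ (CkM oU1 (CkB oU1 (Cc k U1 1) (Ck_cst k U1 v0))
      (CkV oU1 _ (Cden k U1 oU1)))) => x Ux; first by rewrite mxE.
    exact: lt0r_neq0.
  - apply: smooth_on_rV => //; apply: forall_ord2 => k.
      apply: (Ck_eq oV1 _ (CkD oV1 (Ck_cst k V1 u0) (Cc k V1 0))) => x _.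
      by rewrite mxE.
    apply: (Ck_eq oV1 _ (CkD oV1 (Ck_cst k V1 v0) (CkM oV1 (Cc k V1 1)
      (CkV oV1 _ (Cden' k V1 oV1))))) => x Ux; first by rewrite mxE.
    exact: lt0r_neq0.
  - move=> x Ux; have nz : den x != 0 := lt0r_neq0 Ux.
    have E1 : den' (phi x) = (den x)^-1.
      by rewrite /den' mxE /= /sg; move: nz; rewrite /den => nz; field.
    split; first by rewrite /V1 /= E1 invr_gt0.
    apply/rowP; apply: forall_ord2; rewrite mxE /= ?E1 mxE /=; first by rewrite subrKC.
    by rewrite invrK /sg divfK // subrKC.
  - move=> y Vy; have nz : den' y != 0 := lt0r_neq0 Vy.
    have E2 : psi y 0 1 - v0 = y 0 1 / den' y by rewrite mxE /= addrC addKr.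
    have E1 : den (psi y) = (den' y)^-1.
      by rewrite /den E2; move: nz; rewrite /den' => nz; field.
    split; first by rewrite /U1 /= E1 invr_gt0.
    apply/rowP; apply: forall_ord2; rewrite mxE /=; first by rewrite mxE /= addrC addKr.
    by rewrite /sg E1 E2 invrK divfK.
exists phi, G; split => //.
- by apply/rowP; apply: forall_ord2; rewrite !mxE /= ?subrr ?sgp.
- exists V, U', Psi; split => //; first by rewrite fp.
    by split => //; exact: smooth_on_rV.
  by apply: smooth_on_rV => // j; exact: Cinf_sub (CPsi j).
- by rewrite fp /cusp25 !mxE row30 //; have [_ ->] := U'V 0 U'0.
apply/near_norm.
have [rho rho0 Hrho] := open_norm oU' U'0.
(* The bound 1 makes the powers of [sg x] no larger than [sg x] itself, so one estimate controls all
   of them. *)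
have e0 : 0 < Num.min 1 (Num.min d rho) by rewrite !lt_min ltr01 d0.
have [del del0 Hdel] := isbigO_small (isbigO_mobius (- tau)) e0.
have Dp : domain p by [].
have U1p : U1 p by rewrite /U1 /= denp ltr01.
have [s s0 Hs] := near_norm2 (open_norm (open_domain oI oJ) Dp) (open_norm oU1 U1p).
exists (Num.min s (Num.min del rho)); first by rewrite !lt_min s0 del0.
move=> x; rewrite !lt_min => /and3P[/Hs [Dx U1x] xdel xrho].
have tdel : `|x 0 1 - v0| < del.
  by apply: le_lt_trans xdel; have := entry_le_norm (x - p) 0 1; rewrite !mxE.
have trho : `|x 0 0 - u0| < rho.
  by apply: le_lt_trans xrho; have := entry_le_norm (x - p) 0 0; rewrite !mxE.
have := Hdel _ tdel; rewrite mulNr opprK -/(den x) -/(sg x) !lt_min => /and3P[sg1 sgd sgr].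
have sgX n : `|sg x ^+ n.+1| <= `|sg x|.
  by rewrite normrX exprS ler_piMr // exprn_ile1 // ltW.
have sg2d : sg x ^+ 2 < d.
  by apply: le_lt_trans sgd; apply: le_trans (sgX 1%N); exact: ler_norm.
rewrite -(PsiE x (sg x)) // /cusp25 !mxE /=.
suff /U'V [_ ->] : U' (row3 (x 0 0 - u0) (sg x ^+ 2) (sg x ^+ 5)) by [].
apply: Hrho; rewrite subr0; apply: norm_lt_entries => // i; rewrite ord1.
apply: forall_ord3; rewrite row3E //; first exact: le_lt_trans (sgX 1%N) sgr.
exact: le_lt_trans (sgX 4%N) sgr.
Qed.

Lemma necessity : A_equiv f (@cusp25 R) p 0 -> mu != 0.
Proof.
move=> [phi [Phi [[U [V [psi [[oU Up] [oV sphi] spsi UV VU]]]] phip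
  [U' [V' [_ [[oU' U'p] [_ sPhi] _ _ _]]]] _ /near_norm [r3 r30 Hr3]]]].
apply/negP => /eqP mu0.
have [L1 [r1 [L10 r10 lipPhi]]] := smooth_on_lipschitz oU' U'p sPhi.
have [Vp _] := UV _ Up.
have [L2 [r2 [L20 r20 lippsi]]] := smooth_on_lipschitz oV Vp spsi.
pose x t : 'rV[R]_2 := p + t *: e_v R.
have x0 : x 0 = p by rewrite /x scale0r addr0.
have xE t : (x t 0 0 = u0) * (x t 0 1 = v0 + t).
  by rewrite !mxE /= mulr0 mulr1 addr0.
pose gam j t := phi (x t) 0 j.
have oS : open [set t | U (x t)] by have [] := smooth_on_line p (e_v R) 0 oU sphi.
have S0 : [set t | U (x t)] 0 by rewrite /= x0.
have Cgam j : Cinf [set t | U (x t)] (gam j).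
  by have [_] := smooth_on_line p (e_v R) j oU sphi.
have gam0 j : gam j 0 = 0 by rewrite /gam x0 phip mxE.
have fx t : J (v0 + t) -> f (x t) = alpha u0 + beta (v0 + t).
  by move=> Jt; rewrite fE !xE.
have Jp0 : J (v0 + 0) by rewrite addr0.
have Obeta j : isbigO 2 (fun t => beta (v0 + t) 0 j - beta v0 0 j).
  have O2 := isbigOW (isT : (2 <= 6)%N) (beta_expansion j).
  have O3 := @isbigO_monomialW R 3 2 (e3 j) isT.
  have O4 := @isbigO_monomialW R 4 2 (e4 j) isT.
  have O5 := @isbigO_monomialW R 5 2 (e5 j) isT.
  have := isbigOD O2 (isbigOD (isbigOD (isbigO_monomial 2 (e2 j)) O3) (isbigOD O4 O5)).
  by apply: isbigO_ext => t; ring.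
have Ox : isbigO 1 (fun t => `|x t - p|).
  apply: isbigO_norm_rV => j; apply: isbigO_ext (isbigO_monomial 1 (e_v R 0 j)) => t.
  by rewrite expr1 mulrC /x (addrC p) addrK [RHS]mxE.
have Ob : isbigO 2 (fun t => `|beta (v0 + t) - beta v0|).
  by apply: isbigO_norm_rV => j; apply: isbigO_ext (Obeta j) => t; rewrite !mxE.
have Og j : isbigO 1 (gam j).
  apply: isbigO_ext (taylorP 1 oS S0 (Cgam j)) => t.
  by rewrite horner_poly big_ord1 /= gam0 !mul0r subr0.
have Ogam : isbigO 1 (fun t => `|phi (x t)|) by apply: isbigO_norm_rV => j; exact: Og.
have [d1 d10 Hd1] := open_norm (open_shift (v := v0) oJ) Jp0.
have [d2 d20 Hd2] := isbigO_small Ox r30.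
have [d3 d30 Hd3] := isbigO_small (isbigOW (isT : (1 <= 2)%N) Ob) r10.
have [d4 d40 Hd4] := isbigO_small Ogam r20.
have [d5 d50 Hd5] := open_norm oS S0.
pose d := Num.min (Num.min d1 d2) (Num.min (Num.min d3 d4) d5).
have d0 : 0 < d by rewrite !lt_min d10 d20 d30 d40.
have good t : `|t| < d -> [/\ f (x t) = alpha u0 + beta (v0 + t),
    Phi (f (x t)) = cusp25 (phi (x t)), `|f (x t) - f p| < r1,
    `|phi (x t) - phi p| < r2 & psi (phi (x t)) = x t].
  rewrite !lt_min => /andP[/andP[t1 t2] /andP[/andP[t3 t4] t5]].
  have Jt : J (v0 + t) by apply: Hd1; rewrite subr0.
  have fxt := fx _ Jt; have := fx _ Jp0; rewrite x0 addr0 => fpE.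
  split => //.
  - by apply: Hr3; have := Hd2 _ t2; rewrite normr_id.
  - rewrite fxt fpE opprD addrACA subrr add0r.
    by have := Hd3 _ t3; rewrite normr_id.
  - by rewrite phip subr0; have := Hd4 _ t4; rewrite normr_id.
  - have Ut : U (x t) by apply: Hd5; rewrite subr0.
    by have [] := UV _ Ut.
have lip t s j : `|t| < d -> `|s| < d ->
    `|cusp25 (phi (x t)) 0 j - cusp25 (phi (x s)) 0 j| <= L1 * `|beta (v0 + t) - beta (v0 + s)|.
  move=> /good [ft Pt rt _ _] /good [fs Ps rs _ _]; rewrite -Pt -Ps.
  have := entry_le_norm (Phi (f (x t)) - Phi (f (x s))) 0 j; rewrite !mxE => /le_trans -> //.
  by rewrite (le_trans (lipPhi _ _ rs rt)) // ft fs opprD addrACA subrr add0r.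
have Og0 : isbigO 2 (gam 0).
  apply: (isbigO_le_near (L := L1) _ Ob); exists d => // t td; rewrite normr_id.
  have := lip t 0 0 td; rewrite normr0 => /(_ d0); rewrite x0 phip addr0 !mxE /=.
  by rewrite subr0.
pose m := derive1 (gam 1) 0.
have Om : isbigO 2 (fun t => gam 1 t - m * t).
  apply: isbigO_ext (taylorP 2 oS S0 (Cgam 1)) => t.
  rewrite horner_poly !big_ord_recr big_ord0 /= gam0 -/m.
  by rewrite mul0r mul0r !add0r divr1.
have m0 : m != 0.
  (* Otherwise both components of [phi] are O(t^2) along the curve, and the Lipschitz inverse [psi]
     would give t = O(t^2). *)
  apply/eqP => mz; rewrite mz in Om.
  have Og1 : isbigO 2 (gam 1) by apply: isbigO_ext Om => t; rewrite mul0r subr0.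
  have Og2 : isbigO 2 (fun t => `|phi (x t)|).
    by apply: isbigO_norm_rV; exact: forall_ord2.
  have OX : isbigO 2 (horner 'X : R -> R).
    apply: (isbigO_le_near (L := L2) _ Og2); exists d => // t td; rewrite hornerX normr_id.
    have [_ _ _ rt Et] := good t td.
    have n0 : `|0 : R| < d by rewrite normr0.
    have [_ _ _ rp Ep] := good 0 n0; rewrite x0 in rp Ep.
    have := lippsi _ _ rp rt.
    rewrite Et Ep phip subr0; apply: le_trans.
    have := entry_le_norm (x t - p) 0 1; apply: le_trans.
    by rewrite !mxE /= mulr1 addrC addKr.
  have sX : (size ('X : {poly R}) <= 2)%N by rewrite size_polyX.
  by have /eqP := poly_isbigO_eq0 sX OX; rewrite polyX_eq0.
(* Solves the order 5 equation for the [q0]-component; the [q1]-component of that equation is a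
   multiple of [mu], which is 0 here. *)
pose tau4 := - ((W2 * tau ^+ 2 + W3 * tau + W4 / 5) / W1).
pose T (a s : R) := a * s + tau * s ^+ 2 + tau4 * s ^+ 4.
have OT a : isbigO 1 (T a).
  do 2 (apply: isbigOD; last exact: isbigO_monomialW).
  exact: (isbigO_monomial 1 a).
have Oodd j : isbigO 6 (fun s => beta (v0 + T 1 s) 0 j - beta (v0 + T (-1) s) 0 j).
  have E3 : 4 * e2 j * tau + 2 * e3 j = 0 by rewrite /e2 /e3 /tau; field.
  have E5 : 4 * e2 j * tau4 + 6 * e3 j * tau ^+ 2 + 8 * e4 j * tau + 2 * e5 j = 0.
    have c3E : c3 = 2 * W2 * c2 / (3 * W1).
      by apply/eqP; rewrite -subr_eq0; apply/eqP; move: mu0; rewrite /mu => h;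
        transitivity ((3 * W1 * c3 - 2 * W2 * c2) / (3 * W1)); [field|rewrite h mul0r].
    by rewrite /e2 /e3 /e4 /e5 /tau4 /tau c3E; field.
  apply: isbigO_ext (odd_part_vanishes (beta_expansion j) E3 E5) => s.
  by rewrite /T mul1r mulN1r.
have Odiff : isbigO 6 (fun s => gam 1 (T 1 s) ^+ 5 - gam 1 (T (-1) s) ^+ 5).
  have O6 : isbigO 6 (fun s => `|beta (v0 + T 1 s) - beta (v0 + T (-1) s)|).
    by apply: isbigO_norm_rV => j; apply: isbigO_ext (Oodd j) => s; rewrite !mxE.
  have [s1 s10 Hs1] := isbigO_small (OT 1) d0.
  have [s2 s20 Hs2] := isbigO_small (OT (-1)) d0.
  apply: (isbigO_le_near (L := L1) _ O6); exists (Num.min s1 s2); first by rewrite lt_min s10.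
  move=> s; rewrite lt_min => /andP[/Hs1 t1 /Hs2 t2]; rewrite normr_id.
  by have := lip _ _ 2 t1 t2; rewrite !mxE.
(* For [a = 1] and [a = -1] the leading terms are [m s] and [- m s]; their fifth powers differ by
   [2 m^5 s^5], which cannot be O(s^6). *)
have OS a : isbigO 2 (fun s => gam 1 (T a s) - (m * a) * s).
  have O1 := isbigO_comp Om (OT a).
  have O2 := isbigOZ m (isbigOD (isbigO_monomial 2 tau) (@isbigO_monomialW R 4 2 tau4 isT)).
  by apply: isbigO_ext (isbigOD O1 O2) => s; rewrite /T; ring.
have OS5 a := isbigO_subXX 5 (isbigO_comp (Og 1) (OT a)) (isbigO_monomial 1 (m * a)) (OS a).
have OX : isbigO 6 (horner ((2 * m ^+ 5) *: 'X^5)).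
  apply: isbigO_ext (isbigOD (isbigOB Odiff (OS5 1)) (OS5 (-1))) => s.
  rewrite hornerZ hornerXn expr1; ring.
have sX : (size ((2 * m ^+ 5) *: 'X^5 : {poly R}) <= 6)%N.
  by rewrite (leq_trans (size_scale_leq _ _)) // size_polyXn.
have /eqP := poly_isbigO_eq0 sX OX; rewrite scaler_eq0 mulf_eq0 pnatr_eq0 /= expf_eq0.
by rewrite (negPf m0) /= -size_poly_eq0 size_polyXn.
Qed.

Lemma cusp25_criterion : A_equiv f (@cusp25 R) p 0 <->
  derive1 (fun v => derive1 (derive1 g2) v / derive1 w2 v) v0 != 0.
Proof.
by split=> [/necessity|] H; [exact/quotient_condition|exact/sufficiency/quotient_condition].
Qed.

End normal_form.

Theorem theorem4p3 (R : realType) (I J : set R)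
  (g1 w1 g2 w2 : R -> R) (alpha beta : R -> 'rV[R]_3)
  (f : 'rV[R]_2 -> 'rV[R]_3) (p : 'rV[R]_2) :
  open I -> open J ->
  smooth_on I g1 -> smooth_on I w1 -> smooth_on J g2 -> smooth_on J w2 ->
  (* f(u,v) = 1/2 int (-1-g1^2, 1-g1^2, 2 g1) w1 du + 1/2 int (1+g2^2, 1-g2^2, -2 g2) w2 dv + const *)
  (forall u, I u -> is_derive u 1 alpha
     ((2^-1 * w1 u) *: row3 (- 1 - g1 u ^+ 2) (1 - g1 u ^+ 2) (2 * g1 u))) ->
  (forall v, J v -> is_derive v 1 beta
     ((2^-1 * w2 v) *: row3 (1 + g2 v ^+ 2) (1 - g2 v ^+ 2) (- (2 * g2 v)))) ->
  (forall x : 'rV[R]_2, I (x 0 0) -> J (x 0 1) -> f x = alpha (x 0 0) + beta (x 0 1)) ->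
  (* f is an immersion on an open dense subset of the domain *)
  [set x : 'rV[R]_2 | I (x 0 0) /\ J (x 0 1)] `<=`
    closure [set x : 'rV[R]_2 | I (x 0 0) /\ J (x 0 1) /\ immersion_at f x] ->
  I (p 0 0) -> J (p 0 1) ->
  (* p is a non-degenerate singular point *)
  ~ immersion_at f p ->
  (derive (lambda_fn f g1 g2) p (e_u R) != 0 \/ derive (lambda_fn f g1 g2) p (e_v R) != 0) ->
  \rank (jac f p) = 1%N ->
  w2 (p 0 1) = 0 ->
  ~ front_at f g1 g2 p ->
  (A_equiv f (@cusp25 R) p 0 <->
   derive1 (fun v => derive1 (derive1 g2) v / derive1 w2 v) (p 0 1) != 0).
Proof.
move=> oI oJ /smooth_on_Cinf Cg1 /smooth_on_Cinf Cw1 /smooth_on_Cinf Cg2 /smooth_on_Cinf Cw2.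
move=> Da Db fE _ Ip Jp _ nd _ w20 nf.
have [w10 ab1 W10] := nondegenerate_data oI oJ Cg1 Cw1 Cg2 Cw2 Da Db fE Ip Jp w20 nd.
have g20 := not_front_data oI oJ Cg1 Cg2 Da Db fE Ip Jp w20 w10 nf.
exact: (cusp25_criterion oI oJ Cg1 Cw1 Cg2 Cw2 Da Db fE Ip Jp w10 ab1 W10 w20 g20).
Qed.
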